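(* Let $f\in L^\infty(\mathbb{R})$. Let $F(x)=f(x)\chi_{\mathbb{R}\setminus[-1,1]}(x)/x^2$ and let $\Psi_f(s)=\hat F(s)=\int_{|t|>1}e^{-ist}f(t)\,\frac{dt}{t^2}$ for $s\in\mathbb{R}$. Then: (a) $\|\Psi_f\|_\infty\le\|F\|_1$. (b) $F\in L^r(\mathbb{R})$ for each $1/2<r\le\infty$; $\Psi_f\in L^q(\mathbb{R})$ for each $2\le q\le\infty$; and there is a constant $C_p$ (depending only on $p$) such that $\|\Psi_f\|_q\le C_p\|F\|_p$, where $1/p+1/q=1$. (c) $\lim_{|s|\to\infty}\Psi_f(s)=0$. (d) $\Psi_f$ is uniformly continuous on $\mathbb{R}$. (e) If $h\in\mathbb{R}$ with $0<|h|<1/e$, then $|\Psi_f(s+h)-\Psi_f(s)|\le 6\|f\|_\infty|h|\,\bigl|\log|h|\bigr|$ for all $s\in\mathbb{R}$. It follows that $\Psi_f$ is Hölder continuous on $\mathbb{R}$ for each positive exponent less than one. (f) For each $s\in\mathbb{R}$ the estimate in (e) is sharp in the following sense: if $\psi:\mathbb{R}\to(0,\infty)$ and $\psi(h)=o(h\log|h|)$ as $h\to0$, then there is $f\in L^\infty(\mathbb{R})$ such that $(\Psi_f(s+h)-\Psi_f(s))/\psi(h)$ is not bounded as $h\to0$. It follows that $\Psi_f$ need not be Lipschitz continuous (i.e., there is $f\in L^\infty(\mathbb{R})$ for which $\Psi_f$ is not Lipschitz continuous).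
   Context: Functions in $L^\infty(\mathbb{R})$ are complex-valued, bounded and Lebesgue measurable. For $G\in L^1(\mathbb{R})$, $\hat G(s)=\int_{-\infty}^\infty e^{-ist}G(t)\,dt$. A function $g$ on $\mathbb{R}$ is Hölder continuous with exponent $0<\alpha\le1$ if there is a constant $k$ such that $|g(x+h)-g(x)|\le k|h|^\alpha$ for all $h,x\in\mathbb{R}$; it is Lipschitz continuous if $\alpha=1$. *)

(* Defs.v *)
From HB Require Import structures.
From mathcomp Require Import all_boot all_order all_algebra.
From mathcomp Require Import complex.
From mathcomp Require Import all_classical all_reals all_analysis.

Set Implicit Arguments.
Unset Strict Implicit.
Unset Printing Implicit Defensive.

Import Order.TTheory GRing.Theory Num.Theory.
Import numFieldNormedType.Exports.

Local Open Scope classical_set_scope.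
Local Open Scope ring_scope.
Local Open Scope complex_scope.

Notation modulus := ComplexField.Normc.normc.

Section fourier_and_lebesgue_spaces.
Variable R : realType.
Implicit Types (f g G : R -> R[i]) (D : set R) (r : \bar R).

(* [lebesgue_measure] lives on the Borel sets; its completion, used throughout,
   lives on the Caratheodory sigma-algebra, i.e. the Lebesgue measurable sets.
   The carrier of [lebesgueR] is R itself. *)
Local Notation mu := (@completed_lebesgue_measure R).

Local Notation lebesgueR := (caratheodory_type (@wlength R idfun)^*%mu).
Local Notation Re := (@complex.Re R).
Local Notation Im := (@complex.Im R).

Definition lebesgue_measurable g :=
  measurable_fun [set: lebesgueR] (Re \o g : lebesgueR -> R) /\
  measurable_fun [set: lebesgueR] (Im \o g : lebesgueR -> R).

(* For r < 1 this is only a quasi-norm. For r = +oo it is the essential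
   supremum, so [in_L +oo] is boundedness up to a null set. *)
Definition lnorm r g : \bar R := Lnorm mu r (fun x => (modulus (g x))%:E).

Definition in_L r g := lebesgue_measurable g /\ (lnorm r g < +oo)%E.

Definition cintegral D g : R[i] :=
  Rintegral mu D (Re \o g) +i* Rintegral mu D (Im \o g).

Definition expi (x : R) : R[i] := cos x +i* sin x.

(* [cintegral], hence [fourier G], is meaningful only for G in L^1: elsewhere
   the real integrals take default values. *)
Definition fourier G (s : R) : R[i] :=
  cintegral setT (fun t => expi (- (s * t)) * G t).

Definition truncF f (x : R) : R[i] :=
  if `|x| <= 1 then 0 else f x / (x ^+ 2)%:C.

Definition Psi f : R -> R[i] := fourier (truncF f).

Lemma PsiE f s : Psi f s =
  cintegral [set t | 1 < `|t|] (fun t => expi (- (s * t)) * f t / (t ^+ 2)%:C).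
Proof.
have E (h : R[i] -> R) : h 0 = 0 ->
  Rintegral mu setT (h \o (fun t => expi (- (s * t)) * truncF f t)) =
  Rintegral mu [set t | 1 < `|t|]
    (h \o (fun t => expi (- (s * t)) * f t / (t ^+ 2)%:C)).
  move=> h0; rewrite [RHS]Rintegral_mkcond; apply: eq_Rintegral => t _ /=.
  rewrite patchE /truncF; case: ifPn => [t1|]; last first.
    by rewrite -ltNge => t1; rewrite mem_set// mulrA.
  by rewrite memNset ?mulr0//=; apply/negP; rewrite -leNgt.
by rewrite /Psi /fourier /cintegral !E.
Qed.

Definition holder (alpha : R) g :=
  exists k : R, forall h x : R, modulus (g (x + h) - g x) <= k * `|h| `^ alpha.

Definition lipschitz_continuous g := holder 1 g.

End fourier_and_lebesgue_spaces.

(* Main.v *)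
(* The bound |e^{-iht} - 1| <= min(2, |ht|) gives the
   uniform estimates: splitting the integral of min(2, |h|t)/t^2 over t > 1 at
   t = 1/|h| yields |h||log|h|| + 2|h|, whence (e), the Hoelder estimates and (d).

   The L^2 bound comes from Bessel's inequality. If G is supported in [-L, L], the
   numbers G^(th + k pi/L) are Fourier coefficients of G on that interval, so the
   sum of their squared moduli is at most 2L |G|_2^2; integrating in th over
   [0, pi/L] gives |G^|_2^2 <= 2 pi |G|_2^2, and Fatou's lemma removes the support
   condition. Square integrability and uniform continuity give (c).

   For 1 < p < 2 and q = p/(p-1), put N = |G|_p^p. At height lam the part of G
   where lam |G|^(p-1) > 2N has transform at most lam/2, so only the rest, handled
   by the L^2 bound, contributes to {|G^| > lam}; summing over dyadic heights, the
   geometric series at each point is at most a multiple of N^(q-2) |G|^p.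

   For (f), f(t) = i e^{ist} on t > 1 makes the real part of the increment at s
   equal to the integral of sin(ht)/t^2, which is at least (h/2) log(1/h) - h. *)

Require Import Defs.
From HB Require Import structures.
From mathcomp Require Import all_boot all_order all_algebra.
From mathcomp Require Import complex.
From mathcomp Require Import all_classical all_reals all_analysis.
From mathcomp Require Import measurable_realfun ess_sup_inf ring lra.

Import Order.TTheory GRing.Theory Num.Theory.
Import numFieldNormedType.Exports.

Local Open Scope classical_set_scope.
Local Open Scope ring_scope.
Local Open Scope complex_scope.

Set Implicit Arguments.
Unset Strict Implicit.
Unset Printing Implicit Defensive.

(** * Transfer between the Borel and the completed Lebesgue measure *)

Section completed_lebesgue.
Variable R : realType.
Local Notation mu := (@completed_lebesgue_measure R).
Local Notation leb := (@lebesgue_measure R).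
Local Notation lebesgueR := (caratheodory_type (@wlength R idfun)^*%mu).

(** Since f is bounded, F lies in both L^1 and L^2. Every transform that occurs is then an
    absolutely convergent integral, so the extension of the Fourier transform to L^2 is never
    constructed. Of Plancherel's theorem only an inequality is used, and Bessel's inequality yields
    it without completeness of the exponentials. Interpolation is done by cutting G at real heights
    rather than by analytic continuation in the exponent. The L^1 endpoint has a sup bound, so at
    each height the tall part of G drops out entirely and only L^2 bounds are summed. Stopping at a
    finite dyadic depth keeps all sums finite; the remainder involves |G|_1 and |G|_2, which the
    final constant may not contain, but it decays geometrically in the depth. Norms refer to the
    completed measure, while the explicit integrals concern Borel functions: these are computed for
    the Borel measure and transferred to its completion. *)

Lemma borel_lebesgue_measurable (A : set R) :
  measurable A -> measurable (A : set lebesgueR).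
Proof. exact: sub_caratheodory. Qed.

(** The identity, seen as a measurable map from the Lebesgue sigma-algebra to the Borel one. The
    Borel measure is the pushforward of its completion along it, so transferring an integral is a
    change of variables. *)
Definition to_borel : lebesgueR -> measurableTypeR R := id.

Lemma measurable_to_borel : measurable_fun setT to_borel.
Proof. by move=> _ Y mY; rewrite setTI; exact: borel_lebesgue_measurable. Qed.

HB.instance Definition _ := isMeasurableFun.Build _ _ _ _
  to_borel measurable_to_borel.

Lemma completed_lebesgue_measureE (A : set R) :
  measurable A -> mu A = leb A.
Proof. by []. Qed.

Lemma borel_measurable_fun d (T : measurableType d) (D : set R) (f : R -> T) :
  measurable D ->
  measurable_fun D f ->
  @measurable_fun _ _ lebesgueR T D f.
Proof.
by move=> mD mf _ Y mY; apply: borel_lebesgue_measurable; exact: mf.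
Qed.

Lemma ge0_integral_completed (D : set R) (f : R -> \bar R) :
  measurable D ->
  measurable_fun D f ->
  (forall x, D x -> 0 <= f x)%E ->
  (\int[mu]_(x in D) f x = \int[leb]_(x in D) f x)%E.
Proof.
move=> mD mf f0.
transitivity (\int[pushforward mu to_borel]_(x in D) f x)%E.
  rewrite ge0_integral_pushforward// => y; rewrite inE; exact: f0.
exact: eq_measure_integral.
Qed.

Lemma integrable_completed (D : set R) (f : R -> \bar R) :
  measurable D ->
  leb.-integrable D f -> mu.-integrable D f.
Proof.
move=> mD /integrableP[mf fy]; apply/integrableP; split.
  exact: borel_measurable_fun.
by rewrite ge0_integral_completed//; exact: measurableT_comp.
Qed.

Lemma integral_completed (D : set R) (f : R -> \bar R) :
  measurable D ->
  measurable_fun D f ->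
  (\int[mu]_(x in D) f x = \int[leb]_(x in D) f x)%E.
Proof.
move=> mD mf; rewrite integralE [RHS]integralE.
rewrite !ge0_integral_completed//.
  exact: measurable_funeneg.
exact: measurable_funepos.
Qed.

Lemma Rintegral_completed (D : set R) (f : R -> R) :
  measurable D ->
  measurable_fun D f ->
  Rintegral mu D f = Rintegral leb D f.
Proof.
by move=> mD mf; rewrite /Rintegral integral_completed//; exact/measurable_EFinP.
Qed.

End completed_lebesgue.

(** * Complex-valued integrals *)

Section complex_modulus.
Variable R : realType.
Implicit Types z w : R[i].
Local Notation Re := (@complex.Re R).
Local Notation Im := (@complex.Im R).

Lemma modulusE z : modulus z = Num.sqrt (Re z ^+ 2 + Im z ^+ 2).
Proof. by case: z. Qed.

Lemma modulus_ge0 z : 0 <= modulus z.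
Proof. by rewrite modulusE sqrtr_ge0. Qed.

Lemma sqr_modulus z : modulus z ^+ 2 = Re z ^+ 2 + Im z ^+ 2.
Proof. by rewrite modulusE sqr_sqrtr// addr_ge0// sqr_ge0. Qed.

Lemma modulusM z w : modulus (z * w) = modulus z * modulus w.
Proof. exact: ComplexField.Normc.normcM. Qed.

Lemma modulusN z : modulus (- z) = modulus z.
Proof. exact: complex.normcN. Qed.

Lemma modulusD z w : modulus (z + w) <= modulus z + modulus w.
Proof. exact: complex.le_normcD. Qed.

Lemma modulusB z w : modulus (z - w) <= modulus z + modulus w.
Proof. by rewrite -(modulusN w) modulusD. Qed.

Lemma modulus0 : modulus (0 : R[i]) = 0.
Proof. exact: ComplexField.Normc.normc0. Qed.

Lemma modulus_real (x : R) : modulus x%:C = `|x|.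
Proof. by rewrite modulusE /= expr0n/= addr0 sqrtr_sqr. Qed.

Lemma norm_Re_modulus z : `|Re z| <= modulus z.
Proof. by rewrite modulusE -sqrtr_sqr ler_wsqrtr// lerDl sqr_ge0. Qed.

Lemma norm_Im_modulus z : `|Im z| <= modulus z.
Proof. by rewrite modulusE -sqrtr_sqr ler_wsqrtr// lerDr sqr_ge0. Qed.

Lemma modulus_le_ReIm z : modulus z <= `|Re z| + `|Im z|.
Proof.
rewrite -(@ler_pXn2r _ 2) ?nnegrE ?modulus_ge0 ?addr_ge0//.
rewrite sqr_modulus -(real_normK (num_real (Re z))) -(real_normK (num_real (Im z))).
by rewrite sqrrD lerD2r lerDl mulrn_wge0// mulr_ge0.
Qed.

Lemma ReM z w : Re (z * w) = Re z * Re w - Im z * Im w.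
Proof. by case: z => a b; case: w => c d. Qed.

Lemma ImM z w : Im (z * w) = Re z * Im w + Im z * Re w.
Proof. by case: z => a b; case: w => c d. Qed.

Lemma ReD z w : Re (z + w) = Re z + Re w.
Proof. by case: z => a b; case: w => c d. Qed.

Lemma ImD z w : Im (z + w) = Im z + Im w.
Proof. by case: z => a b; case: w => c d. Qed.

Lemma ImB z w : Im (z - w) = Im z - Im w.
Proof. by case: z => a b; case: w => c d. Qed.

(** Lagrange's identity: the squares of the two sides differ by a square. *)
Lemma cauchy_modulus z (x y : R) :
  Re z * x + Im z * y <= modulus z * modulus (x +i* y).
Proof.
apply: le_trans (ler_norm _) _.
rewrite -(@ler_pXn2r _ 2) ?nnegrE ?mulr_ge0 ?modulus_ge0//.
rewrite exprMn !sqr_modulus real_normK ?num_real//= -subr_ge0.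
have -> : (Re z ^+ 2 + Im z ^+ 2) * (x ^+ 2 + y ^+ 2) -
  (Re z * x + Im z * y) ^+ 2 = (Re z * y - Im z * x) ^+ 2 by ring.
exact: sqr_ge0.
Qed.

Lemma modulus_expi x : modulus (expi x : R[i]) = 1.
Proof. by rewrite modulusE /= cos2Dsin2 sqrtr1. Qed.

Lemma expiD x y : expi (x + y) = expi x * expi y :> R[i].
Proof.
rewrite /expi cosD sinD; apply/eqP; rewrite eq_complex/=.
by apply/andP; split; apply/eqP; [|rewrite addrC].
Qed.

Lemma expi0 : expi 0 = 1 :> R[i].
Proof. by rewrite /expi cos0 sin0. Qed.

End complex_modulus.

Section complex_integral.
Variable R : realType.
Local Notation mu := (@completed_lebesgue_measure R).
Local Notation lebesgueR := (caratheodory_type (@wlength R idfun)^*%mu).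
Local Notation Re := (@complex.Re R).
Local Notation Im := (@complex.Im R).
Local Notation absc := (@ComplexField.Normc.normc R).
Implicit Types (G H : R -> R[i]) (g : R -> R).

Lemma measurable_modulus G : lebesgue_measurable G ->
  measurable_fun [set: lebesgueR] (absc \o G).
Proof.
move=> [mR mI].
rewrite (_ : absc \o G = (fun x => Num.sqrt (Re (G x) ^+ 2 + Im (G x) ^+ 2))); last first.
  by apply/funext => x /=; rewrite modulusE.
apply: measurableT_comp.
  exact: continuous_measurable_fun (@sqrt_continuous R).
by apply: measurable_funD; apply: measurable_funX.
Qed.

Lemma lebesgue_measurableD G H : lebesgue_measurable G -> lebesgue_measurable H ->
  lebesgue_measurable (fun x => G x + H x).
Proof.
move=> [mGR mGI] [mHR mHI]; split.
- rewrite (_ : _ \o _ = (Re \o G) \+ (Re \o H)).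
    exact: measurable_funD.
  by apply/funext => x /=; rewrite ReD.
- rewrite (_ : _ \o _ = (Im \o G) \+ (Im \o H)).
    exact: measurable_funD.
  by apply/funext => x /=; rewrite ImD.
Qed.

Lemma lebesgue_measurableM G H : lebesgue_measurable G -> lebesgue_measurable H ->
  lebesgue_measurable (fun x => G x * H x).
Proof.
move=> [mGR mGI] [mHR mHI]; split.
- rewrite (_ : _ \o _ = ((Re \o G) \* (Re \o H)) \- ((Im \o G) \* (Im \o H))).
    by apply: measurable_funB; apply: measurable_funM.
  by apply/funext => x /=; rewrite ReM.
- rewrite (_ : _ \o _ = ((Re \o G) \* (Im \o H)) \+ ((Im \o G) \* (Re \o H))).
    by apply: measurable_funD; apply: measurable_funM.
  by apply/funext => x /=; rewrite ImM.
Qed.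

Lemma lebesgue_measurable_real g : measurable_fun [set: lebesgueR] g ->
  lebesgue_measurable (fun x => (g x)%:C).
Proof.
move=> mg; split.
- by rewrite (_ : _ \o _ = g).
- by rewrite (_ : _ \o _ = cst 0).
Qed.

Lemma lebesgue_measurable_cst (c : R[i]) : lebesgue_measurable (fun=> c : R[i]).
Proof.
split.
- by rewrite (_ : _ \o _ = cst (Re c)).
- by rewrite (_ : _ \o _ = cst (Im c)).
Qed.

Lemma continuous_lebesgue_measurable g : continuous g ->
  measurable_fun [set: lebesgueR] g.
Proof.
by move=> cg; apply: borel_measurable_fun => //; exact: continuous_measurable_fun.
Qed.

Lemma lebesgue_measurable_expi (s : R) :
  lebesgue_measurable (fun t => expi (- (s * t))).
Proof.
have c : continuous (fun t : R => - (s * t)).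
  by move=> t; apply: continuousN; apply: mulrl_continuous.
split; apply: continuous_lebesgue_measurable => t /=.
- by apply: continuous_comp; [exact: c|exact: continuous_cos].
- by apply: continuous_comp; [exact: c|exact: continuous_sin].
Qed.

Lemma le_integrable_real (f g : R -> R) : measurable_fun [set: lebesgueR] f ->
  (forall x, `|f x| <= g x) -> mu.-integrable setT (EFin \o g) ->
  mu.-integrable setT (EFin \o f).
Proof.
move=> mf fg.
apply: (@le_integrable _ lebesgueR R mu setT measurableT (EFin \o f) (EFin \o g)).
  exact/measurable_EFinP.
by move=> x _; rewrite /= lee_fin (le_trans (fg x))// ler_norm.
Qed.

Definition cintegrable G :=
  mu.-integrable setT (EFin \o (Re \o G)) /\ mu.-integrable setT (EFin \o (Im \o G)).

(** The components are what [cintegral] computes with; the modulus is what the estimates control. *)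
Lemma cintegrableP G : cintegrable G <->
  lebesgue_measurable G /\ mu.-integrable setT (EFin \o (absc \o G)).
Proof.
split.
  move=> [iR iI].
  have mG : lebesgue_measurable G.
    by split; apply/measurable_EFinP; [exact: measurable_int iR|exact: measurable_int iI].
  split=> //.
  apply: (@le_integrable_real _ (fun x => `|Re (G x)| + `|Im (G x)|)).
  - exact: measurable_modulus.
  - by move=> x; rewrite /= (ger0_norm (modulus_ge0 _)) modulus_le_ReIm.
  - by apply: (integrableD measurableT (integrable_abse iR) (integrable_abse iI)).
move=> [[mR mI] iG]; split; apply: (le_integrable_real _ _ iG) => // x.
- exact: norm_Re_modulus.
- exact: norm_Im_modulus.
Qed.

Lemma cintegrable_measurable G : cintegrable G -> lebesgue_measurable G.
Proof. by case/cintegrableP. Qed.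

Lemma cintegrable_modulus G : cintegrable G ->
  mu.-integrable setT (EFin \o (absc \o G)).
Proof. by case/cintegrableP. Qed.

Lemma le_cintegrable G g : lebesgue_measurable G ->
  mu.-integrable setT (EFin \o g) -> (forall x, modulus (G x) <= g x) ->
  cintegrable G.
Proof.
move=> mG ig Gg; apply/cintegrableP; split=> //.
apply: (le_integrable_real _ _ ig); first exact: measurable_modulus.
by move=> x; rewrite /= (ger0_norm (modulus_ge0 _)).
Qed.

Lemma cintegrable_norm_lty G : lebesgue_measurable G ->
  (\int[mu]_x (modulus (G x))%:E < +oo)%E -> cintegrable G.
Proof.
move=> mG Gy; apply/cintegrableP; split=> //; apply/integrableP; split.
  by apply/measurable_EFinP; exact: measurable_modulus.
under eq_integral do rewrite /= (ger0_norm (modulus_ge0 _)).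
exact: Gy.
Qed.

Lemma cintegrableD G H : cintegrable G -> cintegrable H ->
  cintegrable (fun x => G x + H x).
Proof.
move=> iG iH; apply: (@le_cintegrable _ (fun x => modulus (G x) + modulus (H x))).
- exact: lebesgue_measurableD (cintegrable_measurable iG) (cintegrable_measurable iH).
- exact: (integrableD measurableT (cintegrable_modulus iG) (cintegrable_modulus iH)).
- by move=> x; exact: modulusD.
Qed.

Lemma cintegrableM_bounded G H (c : R) : lebesgue_measurable H ->
  (forall x, modulus (H x) <= c) -> cintegrable G ->
  cintegrable (fun x => H x * G x).
Proof.
move=> mH Hc iG; apply: (@le_cintegrable _ (fun x => c * modulus (G x))).
- exact: lebesgue_measurableM mH (cintegrable_measurable iG).
- exact: (integrableZl measurableT c (cintegrable_modulus iG)).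
- by move=> x; rewrite modulusM ler_wpM2r// modulus_ge0.
Qed.

Lemma cintegrableZ G (c : R[i]) : cintegrable G -> cintegrable (fun x => c * G x).
Proof.
exact: (@cintegrableM_bounded _ (fun=> c) (modulus c) (lebesgue_measurable_cst c)).
Qed.

Lemma cintegrableB G H : cintegrable G -> cintegrable H ->
  cintegrable (fun x => G x - H x).
Proof.
move=> iG iH; have := cintegrableD iG (cintegrableZ (-1) iH).
by under [X in cintegrable X]eq_fun do rewrite mulN1r.
Qed.

Lemma cintegrable_expiM G s : cintegrable G ->
  cintegrable (fun t => expi (- (s * t)) * G t).
Proof.
apply: (@cintegrableM_bounded _ _ 1); first exact: lebesgue_measurable_expi.
by move=> x; rewrite modulus_expi.
Qed.

Lemma eq_cintegral G H : G =1 H -> cintegral setT G = cintegral setT H.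
Proof. by move=> /funext ->. Qed.

Lemma cintegralD G H : cintegrable G -> cintegrable H ->
  cintegral setT (fun x => G x + H x) = cintegral setT G + cintegral setT H.
Proof.
move=> [GR GI] [HR HI]; rewrite /cintegral.
rewrite (_ : _ +i* _ + _ = (Rintegral mu setT (Re \o G) + Rintegral mu setT (Re \o H))
  +i* (Rintegral mu setT (Im \o G) + Rintegral mu setT (Im \o H)))//.
rewrite -!RintegralD//; congr (_ +i* _); apply: eq_Rintegral => x _ /=.
  by rewrite ReD.
by rewrite ImD.
Qed.

Lemma cintegralZ (c : R[i]) G : cintegrable G ->
  cintegral setT (fun x => c * G x) = c * cintegral setT G.
Proof.
move=> [GR GI]; rewrite /cintegral.
rewrite (_ : c * (_ +i* _) =
  (Re c * Rintegral mu setT (Re \o G) - Im c * Rintegral mu setT (Im \o G))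
  +i* (Re c * Rintegral mu setT (Im \o G) + Im c * Rintegral mu setT (Re \o G)))//; last first.
  by case: c.
have iZ k g : mu.-integrable setT (EFin \o g) ->
    mu.-integrable setT (EFin \o (fun x => k * g x)).
  exact: (@integrableZl _ lebesgueR R mu setT measurableT k).
rewrite -!RintegralZl//; congr (_ +i* _).
  rewrite -RintegralB//; [|exact: iZ|exact: iZ].
  by apply: eq_Rintegral => x _ /=; rewrite ReM.
rewrite -RintegralD//; [|exact: iZ|exact: iZ].
by apply: eq_Rintegral => x _ /=; rewrite ImM.
Qed.

Lemma cintegralB G H : cintegrable G -> cintegrable H ->
  cintegral setT (fun x => G x - H x) = cintegral setT G - cintegral setT H.
Proof.
move=> iG iH; rewrite -[in RHS]mulN1r -cintegralZ//.
rewrite -(cintegralD iG (cintegrableZ (-1) iH)).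
by apply: eq_cintegral => x; rewrite mulN1r.
Qed.

(* The integral is rotated onto the positive real axis. *)
Lemma modulus_cintegral_le G : cintegrable G ->
  modulus (cintegral setT G) <= Rintegral mu setT (absc \o G).
Proof.
move=> iG; have [GR GI] := iG; have imG := cintegrable_modulus iG.
set z := cintegral _ _.
have [z0|z0] := eqVneq (modulus z) 0.
  by rewrite z0 Rintegral_ge0// => x _; exact: modulus_ge0.
have {}z0 : 0 < modulus z by rewrite lt_neqAle eq_sym z0 modulus_ge0.
have iZ k g : mu.-integrable setT (EFin \o g) ->
    mu.-integrable setT (EFin \o (fun x => k * g x)).
  exact: (@integrableZl _ lebesgueR R mu setT measurableT k).
have -> : modulus z = (modulus z)^-1 *
    Rintegral mu setT (fun x => Re z * Re (G x) + Im z * Im (G x)).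
  rewrite RintegralD//; [|exact: iZ|exact: iZ].
  rewrite (RintegralZl _ measurableT GR) (RintegralZl _ measurableT GI).
  rewrite -!expr2 -sqr_modulus expr2.
  by rewrite mulKf// gt_eqF.
rewrite ler_pdivrMl// -RintegralZl//; apply: le_Rintegral => //.
- exact: (integrableD measurableT (iZ _ _ GR) (iZ _ _ GI)).
- exact: iZ.
- by move=> x _; rewrite (le_trans (cauchy_modulus _ _ _))//=; case: (G x).
Qed.

Lemma modulus_cintegral_le_integral G : cintegrable G ->
  ((modulus (cintegral setT G))%:E <= \int[mu]_x (modulus (G x))%:E)%E.
Proof.
move=> iG; rewrite -(@fineK _ (\int[mu]_x _)%E).
  by rewrite lee_fin modulus_cintegral_le.
by have := integrable_fin_num measurableT (cintegrable_modulus iG).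
Qed.

End complex_integral.

(** * Integrals of continuous functions over compact intervals *)

Section interval_integrals.
Variable R : realType.
Local Notation mu := (@completed_lebesgue_measure R).
Local Notation lebesgueR := (caratheodory_type (@wlength R idfun)^*%mu).
Implicit Types f F g : R -> R.

Lemma is_derive_continuous f F :
  (forall x : R, is_derive x (1 : R) F (f x)) -> continuous F.
Proof.
by move=> dF x; apply/differentiable_continuous/derivable1_diffP; case: (dF x).
Qed.

Lemma continuous_integrable_itv f (a b : R) : continuous f ->
  mu.-integrable `[a, b] (EFin \o f).
Proof.
move=> cf; apply: integrable_completed; first exact: measurable_itv.
apply: continuous_compact_integrable; first exact: segment_compact.
exact: continuous_subspaceT.
Qed.

Lemma Rintegral_itv_completed f (a b : R) : continuous f ->
  Rintegral mu `[a, b] f = Rintegral lebesgue_measure `[a, b] f.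
Proof.
move=> cf; apply: Rintegral_completed; first exact: measurable_itv.
by apply: measurable_funTS; exact: continuous_measurable_fun.
Qed.

Lemma Rintegral_FTC f F (a b : R) : a < b ->
  (forall x : R, is_derive x (1 : R) F (f x)) -> continuous f ->
  Rintegral mu `[a, b] f = F b - F a.
Proof.
move=> ab dF cf; have cF := is_derive_continuous dF.
rewrite Rintegral_itv_completed// /Rintegral (continuous_FTC2 ab _ _ (F := F))//.
- exact: continuous_subspaceT.
- split.
  + by move=> x _; case: (dF x).
  + exact: cvg_at_right_filter (cF a).
  + exact: cvg_at_left_filter (cF b).
- by move=> x _; rewrite derive1E; case: (dF x).
Qed.

Lemma continuous_translate g (c : R) : continuous g -> continuous (fun x => g (x + c)).
Proof.
move=> cg x; apply: continuous_comp; last exact: cg.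
by apply: cvgD; [exact: cvg_id|exact: cvg_cst].
Qed.

Lemma Rintegral_translate g (a b c : R) : a < b -> continuous g ->
  Rintegral mu `[a + c, b + c] g = Rintegral mu `[a, b] (fun x => g (x + c)).
Proof.
move=> ab cg.
have cs : continuous (fun x : R => x + c).
  by move=> x; apply: continuousD; [exact: cvg_id|exact: cvg_cst].
have cgs := continuous_translate (c := c) cg.
rewrite !Rintegral_itv_completed//; congr fine.
have dE : derive1 (fun x : R => x + c) = cst 1.
  apply/funext => x; rewrite derive1E.
  by rewrite deriveD// derive_id derive_cst addr0.
rewrite (@integration_by_substitution_increasing R (fun x : R => x + c) g a b (ltW ab)).
- by apply: eq_integral => x _; rewrite dE /= mulr1.
- by move=> x y _ _ xy; rewrite ltrD2r.
- by rewrite dE => x _; exact: cvg_cst.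
- by rewrite dE; exact: is_cvg_cst.
- by rewrite dE; exact: is_cvg_cst.
- split.
  + by move=> x _; apply: derivableD.
  + exact: cvg_at_right_filter (cs a).
  + exact: cvg_at_left_filter (cs b).
- exact: continuous_subspaceT.
Qed.

Lemma Rintegral_sum (D : set R) n (h : 'I_n -> R -> R) :
  measurable (D : set lebesgueR) ->
  (forall k, mu.-integrable D (EFin \o h k)) ->
  Rintegral mu D (fun x => \sum_(k < n) h k x) = \sum_(k < n) Rintegral mu D (h k).
Proof.
move=> mD ih; rewrite /Rintegral.
under eq_integral do rewrite -sumEFin.
rewrite (integral_sum mD ih) sum_fine// => k _.
exact: (integrable_fin_num mD (ih k)).
Qed.

Lemma integrable_Rsum (D : set R) n (h : 'I_n -> R -> R) :
  measurable (D : set lebesgueR) ->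
  (forall k, mu.-integrable D (EFin \o h k)) ->
  mu.-integrable D (EFin \o (fun x => \sum_(k < n) h k x)).
Proof.
move=> mD ih.
rewrite (_ : _ \o _ = (fun x => \sum_(k < n) (h k x)%:E)%E); last first.
  by apply/funext => x; rewrite /= sumEFin.
exact: (@integrable_sum _ lebesgueR R mu D mD 'I_n (index_enum _) xpredT _ (fun k _ => ih k)).
Qed.

(** Folds [n] adjacent cells of length [d] onto one cell. Applied to the squared modulus of a
    transform, it turns an integral over frequencies into an integral, over one cell, of sums of
    equally spaced samples. *)
Lemma Rintegral_consecutive g (a d : R) n : 0 < d -> continuous g ->
  Rintegral mu `[a, a + n%:R * d] g =
  \sum_(k < n) Rintegral mu `[0, d] (fun x => g (x + (a + k%:R * d))).
Proof.
move=> d0 cg; elim: n => [|n IH].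
  rewrite mul0r addr0 big_ord0 set_itv1 Rintegral_completed//.
    by rewrite Rintegral_set1.
  by apply: measurable_funTS; exact: continuous_measurable_fun.
have nd : a + n%:R * d <= a + n.+1%:R * d by rewrite lerD2l ler_pM2r// ler_nat.
rewrite big_ord_recr/= -IH -(Rintegral_translate (a + n%:R * d) d0 cg) add0r.
rewrite (_ : d + (a + n%:R * d) = a + n.+1%:R * d); last by rewrite -natr1; ring.
have an : a <= a + n%:R * d by rewrite lerDl mulr_ge0// ltW.
have ig : lebesgue_measure.-integrable `[a, a + n.+1%:R * d] (EFin \o g).
  apply: continuous_compact_integrable; first exact: segment_compact.
  exact: continuous_subspaceT.
rewrite !Rintegral_itv_completed//; apply/eqP; rewrite addrC -subr_eq.
rewrite (Rintegral_itvB ig) ?bnd_simp//.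
rewrite Rintegral_itv_obnd_cbnd//; apply: integrableS ig => //.
exact: subset_itvr.
Qed.

End interval_integrals.

(** * The Fourier transform of an integrable function *)

Section fourier_transform.
Variable R : realType.
Local Notation mu := (@completed_lebesgue_measure R).
Local Notation lebesgueR := (caratheodory_type (@wlength R idfun)^*%mu).
Local Notation Re := (@complex.Re R).
Local Notation Im := (@complex.Im R).
Local Notation absc := (@ComplexField.Normc.normc R).
Implicit Types (G H : R -> R[i]).

Lemma fourierB G H s : cintegrable G -> cintegrable H ->
  fourier (fun x => G x - H x) s = fourier G s - fourier H s.
Proof.
move=> iG iH; rewrite /fourier -(cintegralB (cintegrable_expiM s iG) (cintegrable_expiM s iH)).
by apply: eq_cintegral => x; rewrite mulrBr.
Qed.

Lemma modulus_fourier_le G s : cintegrable G ->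
  modulus (fourier G s) <= Rintegral mu setT (absc \o G).
Proof.
move=> iG; apply: le_trans (modulus_cintegral_le (cintegrable_expiM s iG)) _.
rewrite le_eqVlt; apply/orP; left; apply/eqP; apply: eq_Rintegral => x _.
by rewrite /= modulusM modulus_expi mul1r.
Qed.

(** Dominated convergence with majorant |G|. Continuity makes the transform measurable and its
    square integrable on compact intervals. *)
Lemma fourier_ReIm_continuous G : cintegrable G ->
  continuous (Re \o fourier G) /\ continuous (Im \o fourier G).
Proof.
move=> iG.
have cN (y : R) : continuous (fun s : R => - (s * y)).
  by move=> s; apply: cvgN; exact: mulrr_continuous.
have cc (y : R) : continuous (fun s : R => cos (- (s * y))).
  by move=> s; apply: continuous_comp; [exact: cN|exact: continuous_cos].
have cs (y : R) : continuous (fun s : R => sin (- (s * y))).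
  by move=> s; apply: continuous_comp; [exact: cN|exact: continuous_sin].
have cR (y : R) : continuous (fun s : R => Re (expi (- (s * y)) * G y)).
  rewrite (_ : (fun s => _) =
    (fun s => cos (- (s * y)) * Re (G y) - sin (- (s * y)) * Im (G y))).
    by move=> s; apply: cvgB; apply: cvgM;
      [exact: cc|exact: cvg_cst|exact: cs|exact: cvg_cst].
  by apply/funext => u; rewrite ReM.
have cI (y : R) : continuous (fun s : R => Im (expi (- (s * y)) * G y)).
  rewrite (_ : (fun s => _) =
    (fun s => cos (- (s * y)) * Im (G y) + sin (- (s * y)) * Re (G y))).
    by move=> s; apply: cvgD; apply: cvgM;
      [exact: cc|exact: cvg_cst|exact: cs|exact: cvg_cst].
  by apply/funext => u; rewrite ImM.
have B (s x : R) : modulus (expi (- (s * x)) * G x) <= modulus (G x).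
  by rewrite modulusM modulus_expi mul1r.
have in_ball (s : R) : s \in [set` `]s - 1, s + 1[].
  by rewrite inE/= in_itv/= ltrBlDr ltrDl ltr01.
split=> s.
- apply: (@continuity_under_integral R _ lebesgueR mu
    (fun s t => Re (expi (- (s * t)) * G t)) setT measurableT (s - 1) (s + 1)
    _ _ (absc \o G)) => //.
  + by move=> x _; case: (cintegrable_expiM x iG).
  + apply: nearW => y _ x _.
    exact: cR.
  + exact: cintegrable_modulus.
  + move=> x _; apply: nearW => y _ /=.
    exact: le_trans (norm_Re_modulus _) (B _ _).
- apply: (@continuity_under_integral R _ lebesgueR mu
    (fun s t => Im (expi (- (s * t)) * G t)) setT measurableT (s - 1) (s + 1)
    _ _ (absc \o G)) => //.
  + by move=> x _; case: (cintegrable_expiM x iG).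
  + apply: nearW => y _ x _.
    exact: cI.
  + exact: cintegrable_modulus.
  + move=> x _; apply: nearW => y _ /=.
    exact: le_trans (norm_Im_modulus _) (B _ _).
Qed.

Lemma lebesgue_measurable_fourier G : cintegrable G -> lebesgue_measurable (fourier G).
Proof.
move=> /fourier_ReIm_continuous[cR cI].
by split; apply: continuous_lebesgue_measurable.
Qed.

Lemma sqr_fourier_continuous G : cintegrable G ->
  continuous (fun s => modulus (fourier G s) ^+ 2).
Proof.
move=> /fourier_ReIm_continuous[cR cI].
rewrite (_ : (fun s => _) = (fun s => Re (fourier G s) ^+ 2 + Im (fourier G s) ^+ 2)).
  move=> s; apply: cvgD.
  - by apply: cvgM; exact: cR.
  - by apply: cvgM; exact: cI.
by apply/funext => s; rewrite sqr_modulus.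
Qed.

End fourier_transform.

(** * Orthogonality of exponentials on a symmetric interval *)

Section trigonometric_orthogonality.
Variable R : realType.
Local Notation mu := (@completed_lebesgue_measure R).
Implicit Types (G H : R -> R[i]).

Lemma sin_nat_pi (m : nat) : sin (m%:R * pi) = 0 :> R.
Proof.
elim: m => [|m IH]; first by rewrite mul0r sin0.
by rewrite -natr1 mulrDl mul1r sinDpi IH oppr0.
Qed.

Lemma sin_int_pi (m : int) : sin (m%:~R * pi) = 0 :> R.
Proof.
case: m => m; first exact: sin_nat_pi.
by rewrite NegzE mulrNz mulNr sinN sin_nat_pi oppr0.
Qed.

Lemma is_derive_mull (c df x : R) (f : R -> R) :
  is_derive x (1 : R) f df -> is_derive x (1 : R) (fun t => c * f t) (c * df).
Proof. exact: is_deriveZ. Qed.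

(** For nonzero [m] the antiderivative takes equal values at both ends: its sine part vanishes at
    plus and minus m pi, and its cosine part is even. The free coefficients [a] and [b] fit the
    cross terms in the square of a trigonometric polynomial. *)
Lemma trig_orthogonal (L a b : R) (m : int) : 0 < L ->
  Rintegral mu `[- L, L] (fun t => a * cos (m%:~R * pi / L * t)
                             + b * sin (m%:~R * pi / L * t)) =
  if m == 0 then 2 * L * a else 0.
Proof.
move=> L0; set w := m%:~R * pi / L.
have L2 : - L < L by rewrite gtrN.
have dw (x : R) : is_derive x (1 : R) (fun t => w * t) w.
  by have := is_derive_mull w (is_derive_id x 1); rewrite mulr1.
have cw : continuous (fun t : R => w * t) by exact: is_derive_continuous dw.
have cf : continuous (fun t => a * cos (w * t) + b * sin (w * t)).
  move=> t; apply: cvgD; apply: cvgM; try exact: cvg_cst.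
  - by apply: continuous_comp; [exact: cw|exact: continuous_cos].
  - by apply: continuous_comp; [exact: cw|exact: continuous_sin].
have [m0|m0] := eqVneq m 0.
  rewrite (Rintegral_FTC (F := fun t => a * t) L2 _ cf); first by ring.
  move=> x; rewrite /w m0 !mul0r cos0 sin0 mulr0 addr0 mulr1.
  by have := is_derive_mull a (is_derive_id x 1); rewrite mulr1.
have w0 : w != 0.
  apply: mulf_neq0; last by rewrite invr_neq0// lt0r_neq0.
  by apply: mulf_neq0; [rewrite intr_eq0|rewrite lt0r_neq0// pi_gt0].
rewrite (Rintegral_FTC (F := fun t => a / w * sin (w * t) + - b / w * cos (w * t)) L2 _ cf).
  have -> : w * L = m%:~R * pi by rewrite /w divfK// gt_eqF.
  rewrite mulrN (_ : w * L = m%:~R * pi); last by rewrite /w divfK// gt_eqF.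
  by rewrite sinN cosN sin_int_pi; ring.
move=> x.
have dc := is_derive1_comp (is_derive_cos (w * x)) (dw x).
have ds := is_derive1_comp (is_derive_sin (w * x)) (dw x).
have <- : a / w * (cos (w * x) * w) + - b / w * (- sin (w * x) * w) =
  a * cos (w * x) + b * sin (w * x) by field.
exact: is_deriveD (is_derive_mull (a / w) ds) (is_derive_mull (- b / w) dc).
Qed.

End trigonometric_orthogonality.

(** * Bessel's inequality and the Plancherel inequality *)

Section bessel_plancherel.
Variable R : realType.
Local Notation mu := (@completed_lebesgue_measure R).
Local Notation lebesgueR := (caratheodory_type (@wlength R idfun)^*%mu).
Local Notation Re := (@complex.Re R).
Local Notation Im := (@complex.Im R).
Implicit Types (G H : R -> R[i]).

(** [a j k] and [b j k] are the real and imaginary parts of conj(c_j) c_k, so [v j k] is the real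
    part of u_j conj(u_k). The offset [th] cancels in this product, which leaves the frequency (j -
    k) pi / L; only the diagonal survives integration. *)
Lemma trig_polynomial_norm (L th : R) n (c : 'I_n -> R[i]) : 0 < L ->
  let u k t := c k * expi ((th + k%:R * (pi / L)) * t) in
  let X t := \sum_(k < n) Re (u k t) in
  let Y t := \sum_(k < n) Im (u k t) in
  mu.-integrable `[- L, L] (EFin \o (fun t => X t ^+ 2 + Y t ^+ 2)) /\
  Rintegral mu `[- L, L] (fun t => X t ^+ 2 + Y t ^+ 2) =
  2 * L * \sum_(k < n) modulus (c k) ^+ 2.
Proof.
move=> L0 u X Y.
pose a (j k : 'I_n) := Re (c j) * Re (c k) + Im (c j) * Im (c k).
pose b (j k : 'I_n) := Re (c j) * Im (c k) - Im (c j) * Re (c k).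
pose m (j k : 'I_n) : int := j%:Z - k%:Z.
pose v j k t := a j k * cos ((m j k)%:~R * pi / L * t)
              + b j k * sin ((m j k)%:~R * pi / L * t).
have XY : (fun t => X t ^+ 2 + Y t ^+ 2) = (fun t => \sum_(j < n) \sum_(k < n) v j k t).
  apply/funext => t; rewrite !expr2 /X /Y !big_distrlr /= -big_split/=.
  apply: eq_bigr => j _; rewrite -big_split/=; apply: eq_bigr => k _.
  rewrite /v (_ : (m j k)%:~R * pi / L * t =
    (th + j%:R * (pi / L)) * t - (th + k%:R * (pi / L)) * t).
    by rewrite cosB sinB /u !ReM !ImM /expi /= /a /b; ring.
  by rewrite /m rmorphB/= !pmulrn; ring.
have cv j k : continuous (v j k).
  have cw : continuous (fun t : R => (m j k)%:~R * pi / L * t) by exact: mulrl_continuous.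
  move=> t; apply: cvgD; apply: cvgM; try exact: cvg_cst.
  - by apply: continuous_comp; [exact: cw|exact: continuous_cos].
  - by apply: continuous_comp; [exact: cw|exact: continuous_sin].
have mL : measurable (`[- L, L]%classic : set lebesgueR).
  exact: borel_lebesgue_measurable.
have iv j k := continuous_integrable_itv (- L) L (cv j k).
have ivs j := integrable_Rsum mL (iv j).
rewrite XY; split; first exact: integrable_Rsum.
rewrite Rintegral_sum// mulr_sumr; apply: eq_bigr => j _.
rewrite Rintegral_sum//.
under eq_bigr do rewrite trig_orthogonal//.
rewrite (bigD1 j)//= /m subrr eqxx big1 ?addr0; last first.
  by move=> k kj; rewrite subr_eq0 eqz_nat eq_sym (inj_eq val_inj) (negbTE kj).
by rewrite sqr_modulus /a !expr2.
Qed.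

(* Pair G with the trigonometric polynomial P whose coefficients are the
   sampled values of its transform: the integral of G times the conjugate of P
   is the sum to be bounded, while orthogonality computes the norm of P. *)
Lemma bessel (L th : R) n G : 0 < L -> cintegrable G ->
  mu.-integrable setT (EFin \o (fun t => modulus (G t) ^+ 2)) ->
  (forall t, L < `|t| -> G t = 0) ->
  \sum_(k < n) modulus (fourier G (th + k%:R * (pi / L))) ^+ 2 <=
  2 * L * Rintegral mu setT (fun t => modulus (G t) ^+ 2).
Proof.
move=> L0 iG iG2 G0.
pose c (k : 'I_n) := fourier G (th + k%:R * (pi / L)).
pose u (k : 'I_n) t := c k * expi ((th + k%:R * (pi / L)) * t).
pose X t := \sum_(k < n) Re (u k t).
pose Y t := \sum_(k < n) Im (u k t).
have [iXY XYE] := trig_polynomial_norm th c L0.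
pose e (k : 'I_n) t := expi (- ((th + k%:R * (pi / L)) * t)) * G t.
pose h t := Re (G t) * X t + Im (G t) * Y t.
have mL : measurable (`[- L, L]%classic : set lebesgueR).
  exact: borel_lebesgue_measurable.
have hE : h = (fun t => \sum_(k < n) (Re (c k) * Re (e k t) + Im (c k) * Im (e k t))).
  apply/funext => t; rewrite /h /X /Y !mulr_sumr -big_split/=.
  apply: eq_bigr => k _; rewrite /e /u !ReM !ImM /expi /= cosN sinN; ring.
have ie k : cintegrable (e k) by exact: cintegrable_expiM.
have iZ k (g : R -> R) : mu.-integrable setT (EFin \o g) ->
    mu.-integrable setT (EFin \o (fun x => k * g x)).
  exact: (@integrableZl _ lebesgueR R mu setT measurableT k).
have iek k : mu.-integrable setT
    (EFin \o (fun t => Re (c k) * Re (e k t) + Im (c k) * Im (e k t))).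
  exact: (integrableD measurableT (iZ _ _ (ie k).1) (iZ _ _ (ie k).2)).
have ih : mu.-integrable setT (EFin \o h).
  by rewrite hE; exact: (integrable_Rsum (measurableT : measurable [set: lebesgueR])).
set S := \sum_(k < n) _.
have Sh : S = Rintegral mu `[- L, L] h.
  transitivity (Rintegral mu setT h).
    rewrite hE (Rintegral_sum (measurableT : measurable [set: lebesgueR]) iek).
    apply: eq_bigr => k _.
    rewrite (RintegralD measurableT (iZ _ _ (ie k).1) (iZ _ _ (ie k).2)).
    rewrite (RintegralZl _ measurableT (ie k).1) (RintegralZl _ measurableT (ie k).2).
    by rewrite sqr_modulus !expr2.
  rewrite [RHS]Rintegral_mkcond; apply: eq_Rintegral => t _.
  rewrite patchE; case: ifPn => // /negP; rewrite inE/= in_itv/= -ler_norml => /negP.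
  by rewrite -ltNge => Lt; rewrite /h G0// !mul0r addr0.
have iL2 : mu.-integrable `[- L, L] (EFin \o (fun t => modulus (G t) ^+ 2)).
  exact: integrableS iG2.
have iZL k (g : R -> R) : mu.-integrable `[- L, L] (EFin \o g) ->
    mu.-integrable `[- L, L] (EFin \o (fun x => k * g x)).
  exact: (@integrableZl _ lebesgueR R mu `[- L, L] mL k).
(* A weighted Young inequality takes the place of Cauchy-Schwarz for integrals. With weight 1/(4L)
   the second term integrates, by orthogonality, to S/2, which is then absorbed into the left
   side. *)
have hle t : h t <= L * modulus (G t) ^+ 2 + (4 * L)^-1 * (X t ^+ 2 + Y t ^+ 2).
  rewrite sqr_modulus /h -subr_ge0.
  rewrite (_ : _ - _ = (4 * L)^-1 *
    ((2 * L * Re (G t) - X t) ^+ 2 + (2 * L * Im (G t) - Y t) ^+ 2)).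
    by rewrite mulr_ge0 ?invr_ge0 ?mulr_ge0 ?addr_ge0 ?sqr_ge0// ltW.
  by field; rewrite gt_eqF.
have : S <= L * Rintegral mu setT (fun t => modulus (G t) ^+ 2) + (4 * L)^-1 * (2 * L * S).
  rewrite -[X in _ <= _ + _ * X]XYE.
  apply: (@le_trans _ _ (L * Rintegral mu `[- L, L] (fun t => modulus (G t) ^+ 2) +
     (4 * L)^-1 * Rintegral mu `[- L, L] (fun t => X t ^+ 2 + Y t ^+ 2))).
    rewrite Sh -(RintegralZl _ mL iL2) -(RintegralZl _ mL iXY).
    rewrite -(RintegralD mL (iZL _ _ iL2) (iZL _ _ iXY)).
    apply: le_Rintegral => //.
    - exact: integrableS ih.
    - exact: (integrableD mL (iZL _ _ iL2) (iZL _ _ iXY)).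
    by move=> t _; exact: hle.
  rewrite lerD2r ler_pM2l//; apply: fine_le.
  - exact: integrable_fin_num.
  - exact: integrable_fin_num.
  apply: (@ge0_subset_integral _ lebesgueR R mu `[- L, L] setT mL measurableT
    (fun t => (modulus (G t) ^+ 2)%:E) (measurable_int mu iG2)).
  + by move=> x _; rewrite lee_fin sqr_ge0.
  + exact: subsetT.
rewrite (_ : (4 * L)^-1 * (2 * L * S) = S / 2); last by field; rewrite gt_eqF.
lra.
Qed.

(** Removes a truncation from an integral bound: the window of frequencies in the compactly
    supported case, then the support condition itself. *)
Lemma fatou_bound (f : nat -> R -> R) (g : R -> R) (C : \bar R) :
  (forall n, measurable_fun [set: lebesgueR] (f n)) ->
  (forall n x, 0 <= f n x) -> (forall x, f ^~ x @ \oo --> g x) ->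
  (forall n, \int[mu]_x (f n x)%:E <= C)%E -> (\int[mu]_x (g x)%:E <= C)%E.
Proof.
move=> mf f0 fg fC.
have gE x : (g x)%:E = limn_einf (fun n => (f n x)%:E).
  have fgx : (fun n => (f n x)%:E) @ \oo --> (g x)%:E.
    by apply: cvg_EFin; [exact: nearW|exact: fg].
  rewrite is_cvg_limn_einfE; last by apply/cvg_ex; exists (g x)%:E.
  exact/esym/cvg_lim.
under eq_integral do rewrite gE.
apply: le_trans.
  apply: (@fatou _ lebesgueR R mu setT measurableT (fun n x => (f n x)%:E)).
  - by move=> n; apply/measurable_EFinP; exact: mf.
  - by move=> n x _; rewrite lee_fin.
rewrite limn_einf_lim; apply: lime_le; first exact: is_cvg_einfs.
apply: nearW => n; apply: le_trans (fC n).
by apply: ereal_inf_lbound; exists n => /=.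
Qed.

Lemma plancherel_compact (L : R) G : 0 < L -> cintegrable G ->
  mu.-integrable setT (EFin \o (fun t => modulus (G t) ^+ 2)) ->
  (forall t, L < `|t| -> G t = 0) ->
  (\int[mu]_s (modulus (fourier G s) ^+ 2)%:E <=
   2%:E * pi%:E * \int[mu]_t (modulus (G t) ^+ 2)%:E)%E.
Proof.
move=> L0 iG iG2 G0; set g : R -> R := fun s => modulus (fourier G s) ^+ 2.
have cg : continuous g by exact: sqr_fourier_continuous.
pose d := pi / L; have d0 : 0 < d by rewrite divr_gt0// pi_gt0.
pose D n : set R := `[- (n%:R * d), n%:R * d]%classic.
have mD n : measurable (D n : set lebesgueR).
  by apply: borel_lebesgue_measurable; exact: measurable_itv.
apply: (@fatou_bound (fun n => g \_ (D n))).
- move=> n; apply: (measurable_restrictT (g : lebesgueR -> R) (mD n)).1.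
  apply: measurable_funTS.
  exact: continuous_lebesgue_measurable.
- by move=> n x; rewrite patchE; case: ifP => // _; rewrite sqr_ge0.
- move=> x; apply: cvg_near_cst; near=> n.
  rewrite patchE ifT// inE /D/= in_itv/= -ler_norml -ler_pdivrMr//.
  by near: n; exact: nbhs_infty_ger.
move=> n; rewrite (_ : (\int[mu]_x _)%E = (\int[mu]_(x in D n) (g x)%:E)%E); last first.
  rewrite [RHS]integral_mkcond; apply: eq_integral => x _.
  by rewrite !patchE; case: ifP.
have iD := continuous_integrable_itv (- (n%:R * d)) (n%:R * d) cg.
have i2 := integrable_fin_num measurableT iG2.
rewrite -(fineK (integrable_fin_num (mD n) iD)) -(fineK i2).
rewrite -!EFinM lee_fin -/(Rintegral _ _ _) /D.
(* The symmetric window consists of [n + n] cells of length [d], counted from its left end. *)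
have -> : n%:R * d = - (n%:R * d) + (n + n)%:R * d by rewrite natrD; ring.
rewrite opprD opprK {1}natrD (_ : _ - _ = - (n%:R * d)); last by ring.
rewrite (Rintegral_consecutive _ _ d0 cg).
have m0d : measurable (`[0, d]%classic : set lebesgueR) by exact: borel_lebesgue_measurable.
have ig (k : 'I_(n + n)) :
    mu.-integrable `[0, d] (EFin \o (fun x => g (x + (- (n%:R * d) + k%:R * d)))).
  exact: (continuous_integrable_itv 0 d (continuous_translate cg)).
rewrite -(Rintegral_sum m0d ig).
pose C := 2 * L * Rintegral mu setT (fun t => modulus (G t) ^+ 2).
have iC : mu.-integrable `[0, d] (EFin \o (fun=> C)).
  by apply: continuous_integrable_itv; exact: cst_continuous.
apply: (@le_trans _ _ (Rintegral mu `[0, d] (fun=> C))).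
  apply: le_Rintegral => //; first exact: integrable_Rsum.
  (* For fixed [x] the samples are those of Bessel's inequality with offset x - nd. The bound [C]
     depends neither on the offset nor on the number of cells, and its integral over one cell is C
     pi/L, in which L cancels. *)
  move=> x _; rewrite /g; under eq_bigr do rewrite addrA.
  exact: bessel.
have dC (x : R) : is_derive x (1 : R) (fun x => C * x) C.
  by have := is_derive_mull C (is_derive_id x 1); rewrite mulr1.
rewrite (Rintegral_FTC d0 dC); last exact: cst_continuous.
rewrite le_eqVlt; apply/orP; left; apply/eqP.
rewrite /C /d /Rintegral /=; field.
by rewrite gt_eqF.
Unshelve. all: by end_near. Qed.

End bessel_plancherel.

Section plancherel_inequality.
Variable R : realType.
Local Notation mu := (@completed_lebesgue_measure R).
Local Notation lebesgueR := (caratheodory_type (@wlength R idfun)^*%mu).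
Local Notation absc := (@ComplexField.Normc.normc R).
Implicit Types (G H : R -> R[i]).

(** Serves both for truncating the support, with [A] an interval, and for truncating the height,
    with [A] a sublevel set of |G|. As a product it inherits measurability from its factors. *)
Definition cutoff (A : set R) G : R -> R[i] := fun t => (\1_A t)%:C * G t.

Lemma cutoffE (A : set R) G t : cutoff A G t = if t \in A then G t else 0.
Proof. by rewrite /cutoff indicE; case: ifP => _; rewrite ?mul1r ?mul0r. Qed.

Lemma lebesgue_measurable_cutoff (A : set R) G : measurable (A : set lebesgueR) ->
  lebesgue_measurable G -> lebesgue_measurable (cutoff A G).
Proof.
move=> mA mG; apply: (lebesgue_measurableM _ mG); apply: lebesgue_measurable_real.
exact: (@measurable_indic _ lebesgueR R setT A mA).
Qed.

Lemma cintegrable_cutoff (A : set R) G : measurable (A : set lebesgueR) ->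
  cintegrable G -> cintegrable (cutoff A G).
Proof.
move=> mA iG; apply: (@le_cintegrable _ _ (absc \o G)).
- exact: lebesgue_measurable_cutoff mA (cintegrable_measurable iG).
- exact: cintegrable_modulus.
- by move=> x; rewrite cutoffE; case: ifP => // _; rewrite modulus0 modulus_ge0.
Qed.

Lemma measurable_sqr_modulus G : lebesgue_measurable G ->
  measurable_fun [set: lebesgueR] (fun t => modulus (G t) ^+ 2).
Proof. by move=> mG; apply: measurable_funX; exact: measurable_modulus. Qed.

Lemma sqr_modulus_cutoff_le (A : set R) G t :
  modulus (cutoff A G t) ^+ 2 <= modulus (G t) ^+ 2.
Proof. by rewrite cutoffE; case: ifP => // _; rewrite modulus0 expr0n sqr_ge0. Qed.

Lemma integrable_sqr_cutoff (A : set R) G : measurable (A : set lebesgueR) ->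
  lebesgue_measurable G ->
  mu.-integrable setT (EFin \o (fun t => modulus (G t) ^+ 2)) ->
  mu.-integrable setT (EFin \o (fun t => modulus (cutoff A G t) ^+ 2)).
Proof.
move=> mA mG; apply: le_integrable_real.
- exact: measurable_sqr_modulus (lebesgue_measurable_cutoff mA mG).
- by move=> x; rewrite ger0_norm ?sqr_ge0// sqr_modulus_cutoff_le.
Qed.

Lemma modulus_dist (z w : R[i]) : `|modulus z - modulus w| <= modulus (z - w).
Proof.
have E : modulus (w - z) = modulus (z - w) by rewrite -opprB modulusN.
have := modulusD (w - z) z; have := modulusD (z - w) w; rewrite !subrK E => h1 h2.
by rewrite ler_norml; apply/andP; split; lra.
Qed.

(** Dominated convergence: at each point the integrand is eventually zero. It gives pointwise
    convergence of the transforms of truncations, and later the smallness at infinity of the mass of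
    |Psi f|^2. *)
Lemma cvg_tail_integral G : cintegrable G ->
  Rintegral mu setT (fun t => modulus (G t - cutoff `[- n%:R, n%:R]%classic G t))
    @[n --> \oo] --> (0 : R).
Proof.
move=> iG.
pose f n t := modulus (G t - cutoff `[- n%:R, n%:R]%classic G t).
have mA n : measurable (`[- n%:R, n%:R]%classic : set lebesgueR).
  exact: borel_lebesgue_measurable.
have iC n := cintegrable_cutoff (mA n) iG.
have mf n : measurable_fun [set: lebesgueR] (f n).
  exact: measurable_modulus (cintegrable_measurable (cintegrableB iG (iC n))).
have [|||||_ _ +] := @dominated_convergence _ lebesgueR R mu setT measurableT
  (fun n t => (f n t)%:E) (cst 0%E) (EFin \o (absc \o G)).
- by move=> n; apply/measurable_EFinP; exact: mf.
- exact: measurable_cst.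
- apply: nearW => t _; apply: cvg_near_cst; near=> n.
  rewrite /f cutoffE ifT ?subrr ?modulus0// inE/= in_itv/= -ler_norml.
  by near: n; exact: nbhs_infty_ger.
- exact: cintegrable_modulus.
- apply: nearW => t n _; rewrite /= lee_fin (ger0_norm (modulus_ge0 _)).
  rewrite /f cutoffE; case: ifP => _; last by rewrite subr0.
  by rewrite subrr modulus0 modulus_ge0.
rewrite integral0; exact: fine_cvg.
Unshelve. all: by end_near. Qed.

Lemma plancherel_le_integral G : cintegrable G ->
  mu.-integrable setT (EFin \o (fun t => modulus (G t) ^+ 2)) ->
  (\int[mu]_s (modulus (fourier G s) ^+ 2)%:E <=
   2%:E * pi%:E * \int[mu]_t (modulus (G t) ^+ 2)%:E)%E.
Proof.
move=> iG iG2; have mG := cintegrable_measurable iG.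
(* The successor keeps the radius positive, as the compactly supported case requires. *)
pose A n : set R := `[- n.+1%:R, n.+1%:R]%classic.
have mA n : measurable (A n : set lebesgueR).
  by apply: borel_lebesgue_measurable; exact: measurable_itv.
have iC n := cintegrable_cutoff (mA n) iG.
have iC2 n := integrable_sqr_cutoff (mA n) mG iG2.
apply: (@fatou_bound _ (fun n s => modulus (fourier (cutoff (A n) G) s) ^+ 2)).
- by move=> n; exact: measurable_sqr_modulus (lebesgue_measurable_fourier (iC n)).
- by move=> n x; exact: sqr_ge0.
(* The transforms of the truncations converge because their distance to the full transform is at
   most the L^1 tail of G. *)
- move=> s; apply: (@cvg_comp _ _ _ _ (fun x => x ^+ 2)); last exact: exprn_continuous.
  have := cvg_tail_integral iG; rewrite -(cvg_shiftS) => T0.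
  apply/cvgrPdist_le => e e0; near=> n.
  apply: le_trans (modulus_dist _ _) _.
  rewrite -(fourierB s iG (iC n)).
  apply: le_trans (modulus_fourier_le s _) _.
    exact: cintegrableB iG (iC n).
  near: n; move/cvgrPdist_le : T0 => /(_ _ e0); apply: filterS => n.
  by rewrite sub0r normrN; apply: le_trans; exact: ler_norm.
move=> n; apply: le_trans (@plancherel_compact _ n.+1%:R _ _ (iC n) (iC2 n) _) _.
- by rewrite ltr0n.
- move=> t nt; rewrite cutoffE ifF//; apply/negP; rewrite inE/A/= in_itv/= -ler_norml.
  by move/le_lt_trans => /(_ _ nt); rewrite ltxx.
rewrite lee_wpmul2l// ?mule_ge0 ?lee_fin ?pi_ge0//.
apply: (@ge0_le_integral _ lebesgueR R mu setT measurableT _ _ _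
  (measurable_int mu (iC2 n)) (measurable_int mu iG2)).
- by move=> x _; rewrite lee_fin sqr_ge0.
- by move=> x _; rewrite lee_fin sqr_modulus_cutoff_le.
Unshelve. all: by end_near. Qed.

Lemma plancherel_le G : cintegrable G ->
  mu.-integrable setT (EFin \o (fun t => modulus (G t) ^+ 2)) ->
  mu.-integrable setT (EFin \o (fun s => modulus (fourier G s) ^+ 2)) /\
  Rintegral mu setT (fun s => modulus (fourier G s) ^+ 2) <=
  2 * pi * Rintegral mu setT (fun t => modulus (G t) ^+ 2).
Proof.
move=> iG iG2; have PL := plancherel_le_integral iG iG2.
have fin2 := integrable_fin_num measurableT iG2.
rewrite -(fineK fin2) -!EFinM in PL.
have iF : mu.-integrable setT (EFin \o (fun s => modulus (fourier G s) ^+ 2)).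
  apply/integrableP; split.
    apply/measurable_EFinP.
    exact: measurable_sqr_modulus (lebesgue_measurable_fourier iG).
  under eq_integral do rewrite /= ger0_norm ?sqr_ge0//.
  by apply: le_lt_trans PL _; exact: ltry.
split=> //; rewrite -lee_fin; apply: le_trans PL.
by rewrite fineK//; exact: integrable_fin_num.
Qed.

End plancherel_inequality.

(** * Hausdorff-Young by real interpolation *)

Section dyadic_sums.
Variable R : realType.
Implicit Types r q M v y : R.

Lemma powR_half r M : 0 <= M -> (M / 2) `^ r = M `^ r * 2 `^ (- r).
Proof.
move=> M0; rewrite powRM//; congr (_ * _).
by rewrite -(powR_inv1 (a := 2))// -powRrM mulN1r.
Qed.

Lemma powR2N_lt1 r : 0 < r -> 2 `^ (- r) < 1 :> R.
Proof.
move=> r0; rewrite /powR pnatr_eq0/= expR_lt1 mulNr oppr_lt0 mulr_gt0// ln_gt0//.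
by rewrite ltr1n.
Qed.

(** Only heights up to [y] count, so this is a geometric series of ratio 2^(-r) whose largest term
    is at most y^r. The bound is uniform in [M] and [m]. *)
Lemma dyadic_threshold_sum r M y m : 0 < r -> 0 < M -> 0 <= y ->
  \sum_(n < m) (if M / 2 ^+ n <= y then (M / 2 ^+ n) `^ r else 0) <=
  (1 - 2 `^ (- r))^-1 * y `^ r.
Proof.
move=> r0 M0 y0; set C := _^-1.
have C0 : 0 < C by rewrite invr_gt0 subr_gt0 powR2N_lt1.
have CE : 1 + C * 2 `^ (- r) = C.
  by rewrite /C; field; rewrite gt_eqF// subr_gt0 powR2N_lt1.
(* The minimum with [M] strengthens the induction hypothesis: when [M <= y] the head is M^r, the
   tail is at most C (M/2)^r, and [CE] adds them up to C M^r. *)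
suff h : \sum_(n < m) (if M / 2 ^+ n <= y then (M / 2 ^+ n) `^ r else 0)
    <= C * Num.min M y `^ r.
  apply: (le_trans h); rewrite ler_pM2l//; apply: ge0_ler_powR; rewrite ?nnegrE ?(ltW r0)//.
    by rewrite le_min y0 ltW.
  by rewrite ge_min lexx orbT.
elim: m M M0 => [|m IH] M M0; first by rewrite big_ord0 mulr_ge0 ?powR_ge0// ltW.
have M20 : 0 < M / 2 by rewrite divr_gt0.
rewrite big_ord_recl /= expr0 divr1.
under eq_bigr => n _ do rewrite /bump /= add1n exprS invfM mulrA.
have {IH} := IH _ M20; case: (leP M y) => [My|yM] IHM.
- rewrite -[in leRHS]CE mulrDl mul1r lerD2l (le_trans IHM)//.
  by rewrite min_l ?powR_half ?(ltW M0)// ?mulrA 1?mulrAC// ler_pdivrMr//; lra.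
- rewrite add0r (le_trans IHM)// ler_pM2l//; apply: ge0_ler_powR; rewrite ?nnegrE ?(ltW r0)//.
    by rewrite le_min y0 ltW.
  by rewrite ge_min lexx orbT.
Qed.

Lemma powR_sub2 q v : 2 <= q -> 0 <= v -> v `^ q = v `^ (q - 2) * v ^+ 2.
Proof.
move=> q2; rewrite le_eqVlt => /predU1P[<-|v0].
  by rewrite powR0 ?gt_eqF ?(lt_le_trans _ q2)// expr0n mulr0.
rewrite -powR_mulrn ?ltW// -powRD ?subrK//.
by rewrite (lt0r_neq0 v0) implybT.
Qed.

(** At the first level with M/2^(n+1) < v one has v <= M/2^n, so that single term suffices. If no
    level below [m] is reached, v <= M/2^m and q - 2 of the powers of v are traded for it. The
    factor v^2 stays so that the remainder can be integrated by the L^2 bound. *)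
Lemma dyadic_power_decomposition q M v m : 2 <= q -> 0 < M -> 0 <= v <= M ->
  v `^ q <= \sum_(n < m) (if M / 2 ^+ n.+1 < v then (M / 2 ^+ n) `^ q else 0)
            + (M / 2 ^+ m) `^ (q - 2) * v ^+ 2.
Proof.
move=> q2; elim: m M => [|m IH] M M0 /andP[v0 vM].
  rewrite big_ord0 add0r expr0 divr1 powR_sub2// ler_wpM2r ?sqr_ge0//.
  by apply: ge0_ler_powR; rewrite ?nnegrE ?subr_ge0// ltW.
have M20 : 0 < M / 2 by rewrite divr_gt0.
rewrite big_ord_recl /= expr0 divr1 expr1.
case: ltP => [Mv|vM2].
  rewrite -addrA; apply: ler_wpDr.
    rewrite addr_ge0 ?mulr_ge0 ?powR_ge0 ?sqr_ge0// sumr_ge0// => n _.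
    by case: ifP => // _; rewrite powR_ge0.
  by apply: ge0_ler_powR; rewrite ?nnegrE// ?ltW// (lt_le_trans _ q2).
have := IH _ M20; rewrite v0 vM2 => /(_ isT) /le_trans; apply; rewrite add0r.
have E k : M / 2 / 2 ^+ k = M / 2 ^+ k.+1 by rewrite exprS invfM mulrA.
by rewrite E lerD2r; apply: ler_sum => n _; rewrite !E /bump add1n.
Qed.

End dyadic_sums.

Section hausdorff_young.
Variable R : realType.
Local Notation mu := (@completed_lebesgue_measure R).
Local Notation lebesgueR := (caratheodory_type (@wlength R idfun)^*%mu).
Implicit Types (G H : R -> R[i]).

Lemma measurable_modulus_powR G (p : R) : lebesgue_measurable G ->
  measurable_fun [set: lebesgueR] (fun t => modulus (G t) `^ p).
Proof.
by move=> mG; apply: (measurableT_comp (measurable_powR p)); exact: measurable_modulus.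
Qed.

Lemma integrable_modulus_powR G (p : R) : 1 <= p <= 2 -> cintegrable G ->
  mu.-integrable setT (EFin \o (fun t => modulus (G t) ^+ 2)) ->
  mu.-integrable setT (EFin \o (fun t => modulus (G t) `^ p)).
Proof.
move=> /andP[p1 p2] iG iG2.
apply: (@le_integrable_real _ _ (fun t => modulus (G t) + modulus (G t) ^+ 2)).
- exact: measurable_modulus_powR (cintegrable_measurable iG).
- move=> t; rewrite ger0_norm ?powR_ge0//.
  have := modulus_ge0 (G t); rewrite le_eqVlt => /predU1P[<-|g0].
    by rewrite powR0 ?add0r ?sqr_ge0// gt_eqF// (lt_le_trans _ p1).
  have [g1|g1] := leP (modulus (G t)) 1.
    by apply: ler_wpDr; [exact: sqr_ge0|apply: ge1r_powR; rewrite ?g0].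
  apply: ler_wpDl; first exact: ltW.
  by rewrite -(powR_mulrn 2 (ltW g0)); apply: ler_powR => //; exact: ltW.
- exact: (integrableD measurableT (cintegrable_modulus iG) iG2).
Qed.

(* At level lam, the part of G where |G|^(p-1) exceeds 2N/lam has L^1 norm, hence
   transform, bounded by lam/2: only the small part B contributes. *)
Lemma fourier_weak_split G (p N lam s : R) :
  let B := cutoff [set t | lam * modulus (G t) `^ (p - 1) <= 2 * N] G in
  1 < p -> 0 < N -> 0 < lam -> cintegrable G -> cintegrable B ->
  mu.-integrable setT (EFin \o (fun t => modulus (G t) `^ p)) ->
  Rintegral mu setT (fun t => modulus (G t) `^ p) <= N ->
  lam < modulus (fourier G s) -> lam <= 2 * modulus (fourier B s).
Proof.
move=> B p1 N0 l0 iG iB iGp GN lG.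
have iD := cintegrableB iG iB.
have iZ : mu.-integrable setT (EFin \o (fun t => lam / (2 * N) * modulus (G t) `^ p)).
  exact: (@integrableZl _ lebesgueR R mu setT measurableT _ _ iGp).
(* Where G - B is nonzero, |G|^(p-1) exceeds 2N/lam, hence |G| is at most lam/(2N) times |G|^p,
   whose integral is at most N. *)
have D2 : modulus (fourier (fun t => G t - B t) s) <= lam / 2.
  apply: le_trans (modulus_fourier_le s iD) _.
  apply: (@le_trans _ _ (lam / (2 * N) * N)); last first.
    by rewrite le_eqVlt; apply/orP; left; apply/eqP; field; rewrite gt_eqF.
  apply: (@le_trans _ _ (lam / (2 * N) * Rintegral mu setT (fun t => modulus (G t) `^ p))).
    rewrite -(RintegralZl _ measurableT iGp); apply: le_Rintegral => //.
      exact: cintegrable_modulus iD.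
    move=> t _ /=; rewrite /B cutoffE; case: ifPn => [_|].
      by rewrite subrr modulus0 mulr_ge0 ?powR_ge0// divr_ge0 ?mulr_ge0// ltW.
    rewrite subr0 notin_setE/= => /negP; rewrite -ltNge => lt.
    rewrite mulrAC ler_pdivlMr ?mulr_gt0//.
    rewrite -(@mulr_powRB1 _ (modulus (G t)) p (modulus_ge0 _)) ?(lt_trans _ p1)//.
    by rewrite [leRHS]mulrCA ler_wpM2l ?modulus_ge0// ltW.
  by rewrite ler_wpM2l// divr_ge0 ?mulr_ge0// ltW.
have := modulusD (fourier (fun t => G t - B t) s) (fourier B s).
rewrite fourierB// subrK => h.
rewrite fourierB// in D2.
lra.
Qed.

End hausdorff_young.

Section hausdorff_young_main.
Variable R : realType.
Local Notation mu := (@completed_lebesgue_measure R).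
Local Notation lebesgueR := (caratheodory_type (@wlength R idfun)^*%mu).
Local Notation absc := (@ComplexField.Normc.normc R).
Implicit Types (G H : R -> R[i]).

(** The transform is bounded and square integrable. The majorant depends on |G|_1, so this gives
    only finiteness, which the quantitative bound needs in order to handle real-valued integrals. *)
Lemma integrable_fourier_powR G (q : R) : 2 <= q -> cintegrable G ->
  mu.-integrable setT (EFin \o (fun t => modulus (G t) ^+ 2)) ->
  mu.-integrable setT (EFin \o (fun s => modulus (fourier G s) `^ q)).
Proof.
move=> q2 iG iG2; set M := Rintegral mu setT (absc \o G).
apply: (@le_integrable_real _ _ (fun s => M `^ (q - 2) * modulus (fourier G s) ^+ 2)).
- exact: measurable_modulus_powR (lebesgue_measurable_fourier iG).
- move=> s; rewrite ger0_norm ?powR_ge0// (powR_sub2 q2 (modulus_ge0 _)).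
  rewrite ler_wpM2r ?sqr_ge0//; apply: ge0_ler_powR; rewrite ?nnegrE ?subr_ge0//.
  + exact: modulus_ge0.
  + by apply: Rintegral_ge0 => x _; exact: modulus_ge0.
  + exact: modulus_fourier_le.
- exact: (@integrableZl _ lebesgueR R mu setT measurableT _ _ (plancherel_le iG iG2).1).
Qed.

Lemma le_geometric_limit (a b c rho : R) : 0 <= rho < 1 ->
  (forall m, a <= b + c * rho ^+ m) -> a <= b.
Proof.
move=> /andP[rho0 rho1] H; apply/ler_addgt0Pr => e e0.
have nrho : `|rho| < 1 by rewrite ger0_norm.
have /cvgrPdist_lt/(_ e e0)[m _ /(_ m (leqnn m))] := cvg_geometric c nrho.
rewrite /= sub0r normrN => /ltW h; apply: le_trans (H m) _.
by rewrite lerD2l (le_trans _ h)// ler_norm.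
Qed.

Lemma powR_half_iter (r M : R) m : 0 <= M ->
  (M / 2 ^+ m) `^ r = M `^ r * (2 `^ (- r)) ^+ m.
Proof.
move=> M0; elim: m => [|m IH]; first by rewrite !expr0 divr1 mulr1.
rewrite (_ : M / 2 ^+ m.+1 = M / 2 ^+ m / 2); last by rewrite exprSr invfM mulrA mulrAC.
by rewrite powR_half ?divr_ge0 ?exprn_ge0// IH exprSr mulrA.
Qed.

Lemma conjugate_exponentsE (p q : R) : 0 < p -> 0 < q -> p^-1 + q^-1 = 1 ->
  p * q = p + q.
Proof.
move=> p0 q0 /(congr1 ( *%R (p * q))); rewrite mulr1 => <-.
by field; rewrite !gt_eqF.
Qed.

(** The q-th power of the desired bound: N^(q-1) is N^(q/p) for conjugate exponents. [N] is an upper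
    bound rather than the integral itself, so that it can be positive even when G vanishes almost
    everywhere. *)
Lemma hausdorff_young_power (p q : R) : 1 < p -> p < 2 -> 2 < q ->
  p^-1 + q^-1 = 1 ->
  exists2 K : R, 0 < K & forall G, cintegrable G ->
    mu.-integrable setT (EFin \o (fun t => modulus (G t) ^+ 2)) ->
    forall N, 0 < N -> Rintegral mu setT (fun t => modulus (G t) `^ p) <= N ->
    Rintegral mu setT (fun s => modulus (fourier G s) `^ q) <= K * N `^ (q - 1).
Proof.
move=> p1 p2 q2 pq; have p0 : 0 < p by rewrite (lt_trans _ p1).
have q0 : 0 < q by rewrite (lt_trans _ q2).
have pqE := conjugate_exponentsE p0 q0 pq.
set r := q - 2; have r0 : 0 < r by rewrite subr_gt0.
pose C : R := (1 - 2 `^ (- r))^-1.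
have C0 : 0 < C by rewrite invr_gt0 subr_gt0 powR2N_lt1.
(* The factor 32 pi is 16, from squaring l_n <= 4 |B_n^|, times 2 pi from the L^2 bound; [C] sums
   the geometric series, and 4^r comes from the threshold 4N / |G|^(p-1). *)
exists (32 * pi * C * 4 `^ r).
  by rewrite !mulr_gt0 ?pi_gt0// powR_gt0.
move=> G iG iG2 N N0 GN; have mG := cintegrable_measurable iG.
have iGp : mu.-integrable setT (EFin \o (fun t => modulus (G t) `^ p)).
  by apply: integrable_modulus_powR => //; rewrite !ltW.
(* The added 1 makes the top height positive even if G vanishes almost everywhere. *)
set M := Rintegral mu setT (absc \o G) + 1.
have M0 : 0 < M.
  by rewrite ltr_wpDl//; apply: Rintegral_ge0 => x _; exact: modulus_ge0.
have GM s : modulus (fourier G s) <= M.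
  by apply: le_trans (modulus_fourier_le s iG) _; rewrite lerDl.
pose l n : R := M / 2 ^+ n.
have l0 n : 0 < l n by rewrite divr_gt0// exprn_gt0.
(* The cut uses the height [l n.+1], the one that the transform is known to exceed, whereas the
   weight in the decomposition is a power of [l n]; the ratio 2 between them enters the constant. *)
pose A n : set R := [set t | l n.+1 * modulus (G t) `^ (p - 1) <= 2 * N].
have mA n : measurable (A n : set lebesgueR).
  have mf : measurable_fun [set: lebesgueR]
      (fun t => l n.+1 * modulus (G t) `^ (p - 1)).
    by apply: measurable_funM; [exact: measurable_cst|exact: measurable_modulus_powR].
  rewrite (_ : A n = setT `&` (fun t => l n.+1 * modulus (G t) `^ (p - 1)) @^-1`
      [set` `]-oo, 2 * N]]).
    exact: (mf measurableT _ (measurable_itv _)).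
  by rewrite setTI; apply/seteqP; split=> t; rewrite /A/= in_itv.
pose B n := cutoff (A n) G.
have iB n : cintegrable (B n) by exact: cintegrable_cutoff.
have iB2 n := integrable_sqr_cutoff (mA n) mG iG2.
have iFB n := (plancherel_le (iB n) (iB2 n)).1.
have iF := (plancherel_le iG iG2).1.
have iFq := integrable_fourier_powR (ltW q2) iG iG2.
have iZ k (g : R -> R) : mu.-integrable setT (EFin \o g) ->
    mu.-integrable setT (EFin \o (fun x => k * g x)).
  exact: (@integrableZl _ lebesgueR R mu setT measurableT k).
have mT : measurable [set: lebesgueR] := measurableT.
have pointwise m s : modulus (fourier G s) `^ q <=
    \sum_(n < m) 16 * l n `^ r * modulus (fourier (B n) s) ^+ 2 +
    l m `^ r * modulus (fourier G s) ^+ 2.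
  apply: le_trans (@dyadic_power_decomposition _ q M _ m (ltW q2) M0 _) _.
    by rewrite modulus_ge0 GM.
  rewrite lerD2r; apply: ler_sum => n _; case: ifPn => [lG|_]; last first.
    by apply: mulr_ge0; [apply: mulr_ge0; [exact: ler0n|exact: powR_ge0]|exact: sqr_ge0].
  have := fourier_weak_split p1 N0 (l0 n.+1) iG (iB n) iGp GN lG.
  rewrite -/(B n) => lB; rewrite (powR_sub2 (ltW q2) (ltW (l0 n))) -/r.
  rewrite [leRHS](_ : _ = l n `^ r * (16 * modulus (fourier (B n) s) ^+ 2)); last by ring.
  rewrite ler_wpM2l ?powR_ge0//.
  have lS : l n = 2 * l n.+1 by rewrite /l exprS; field; rewrite expf_neq0.
  rewrite lS (_ : 16 * _ = (2 * (2 * modulus (fourier (B n) s))) ^+ 2); last by ring.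
  have l1 := ltW (l0 n.+1); have b0 := modulus_ge0 (fourier (B n) s).
  apply: lerXn2r; rewrite ?nnegrE.
  - by rewrite pmulr_rge0.
  - by rewrite !pmulr_rge0.
  - by rewrite ler_pM2l.
(* At a point with |G| = u > 0, membership in [A n] means l_n <= 4N / u^(p-1). The sum of l_n^r over
   such n is at most C (4N / u^(p-1))^r, and multiplying by u^2 leaves the exponent -(p-1)(q-2) + 2,
   which is p because pq = p + q. *)
have layers m : Rintegral mu setT (fun t => \sum_(n < m) l n `^ r * modulus (B n t) ^+ 2)
    <= C * (4 * N) `^ r * N.
  apply: (@le_trans _ _ (C * (4 * N) `^ r *
      Rintegral mu setT (fun t => modulus (G t) `^ p))); last first.
    by rewrite ler_wpM2l// mulr_ge0 ?powR_ge0// ltW.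
  rewrite -(RintegralZl _ mT iGp); apply: le_Rintegral => //.
  - by apply: integrable_Rsum => // n; apply: iZ; exact: iB2.
  - exact: iZ.
  move=> t _; have := modulus_ge0 (G t); rewrite le_eqVlt => /predU1P[g0|g0].
    rewrite big1; last first.
      by move=> n _; rewrite /B cutoffE; case: ifP => _; rewrite -?g0 ?modulus0 expr0n mulr0.
    by rewrite mulr_ge0 ?powR_ge0// mulr_ge0 ?powR_ge0// ltW.
  set u := modulus (G t); have up0 : 0 < u `^ (p - 1) by rewrite powR_gt0.
  have := @dyadic_threshold_sum _ r M (4 * N / u `^ (p - 1)) m r0 M0.
  rewrite divr_ge0 ?mulr_ge0 ?powR_ge0 ?(ltW N0)// => /(_ isT).
  rewrite -(ler_pM2r (exprn_gt0 2 g0)) mulr_suml -/u => h.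
  apply: le_trans (le_trans h _).
    apply: ler_sum => n _; rewrite /B cutoffE.
    case: ifPn => [tA|_]; last first.
      rewrite modulus0 expr0n mulr0 mulr_ge0 ?sqr_ge0//.
      by case: ifP => // _; rewrite powR_ge0.
    rewrite ifT// ler_pdivlMr//.
    move: tA; rewrite inE /A/= -/u /l exprS => tA.
    rewrite (_ : M / 2 ^+ n = 2 * (M / (2 * 2 ^+ n))); last by field; rewrite expf_neq0.
    by rewrite -mulrA (_ : 4 * N = 2 * (2 * N)); [rewrite ler_pM2l|ring].
  rewrite -/C le_eqVlt; apply/orP; left; apply/eqP.
  rewrite powRM ?mulr_ge0 ?(ltW N0) ?invr_ge0 ?powR_ge0// -!mulrA; congr (_ * (_ * _)).
  rewrite -powRN -powRrM -powR_mulrn ?modulus_ge0// -powRD; last first.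
    by rewrite (lt0r_neq0 g0) implybT.
  congr (_ `^ _); rewrite /r.
  have -> : - (p - 1) * (q - 2) + 2 = - (p * q) + 2 * p + q :> R by ring.
  by rewrite pqE; ring.
(* [M] and [I2] are not controlled by [N], but they occur only in front of the m-th power of 2^(-r)
   and disappear as m grows. *)
set I2 := Rintegral mu setT (fun t => modulus (G t) ^+ 2).
apply: (@le_geometric_limit _ _ (M `^ r * (2 * pi * I2)) (2 `^ (- r))).
  by rewrite powR_ge0 powR2N_lt1.
move=> m.
have iS n : mu.-integrable setT
    (EFin \o (fun s => 16 * l n `^ r * modulus (fourier (B n) s) ^+ 2)).
  exact: iZ.
apply: (@le_trans _ _ (\sum_(n < m) 16 * l n `^ r * (2 * pi *
    Rintegral mu setT (fun t => modulus (B n t) ^+ 2)) + l m `^ r * (2 * pi * I2))).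
  apply: (@le_trans _ _ (Rintegral mu setT (fun s =>
      \sum_(n < m) 16 * l n `^ r * modulus (fourier (B n) s) ^+ 2 +
      l m `^ r * modulus (fourier G s) ^+ 2))).
    apply: le_Rintegral => //.
    by apply: (integrableD mT (integrable_Rsum mT (fun n : 'I_m => iS n)) (iZ _ _ iF)).
  rewrite (RintegralD mT (integrable_Rsum mT (fun n : 'I_m => iS n)) (iZ _ _ iF)).
  rewrite (Rintegral_sum mT (fun n : 'I_m => iS n)).
  apply: lerD.
    apply: ler_sum => n _; rewrite (RintegralZl _ mT (iFB n)).
    by rewrite ler_wpM2l ?mulr_ge0 ?powR_ge0//; exact: (plancherel_le (iB n) (iB2 n)).2.
  rewrite (RintegralZl _ mT iF) ler_wpM2l ?powR_ge0//.
  exact: (plancherel_le iG iG2).2.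
apply: lerD; last by rewrite /l powR_half_iter ?(ltW M0)// mulrAC.
have iSB n : mu.-integrable setT (EFin \o (fun t => l n `^ r * modulus (B n t) ^+ 2)).
  by apply: iZ; exact: iB2.
have := layers m; rewrite (Rintegral_sum mT (fun n : 'I_m => iSB n)) => h.
rewrite (_ : \sum_(n < m) _ = 32 * pi * \sum_(n < m)
    Rintegral mu setT (fun t => l n `^ r * modulus (B n t) ^+ 2)); last first.
  rewrite mulr_sumr; apply: eq_bigr => n _; rewrite (RintegralZl _ mT (iB2 n)).
  by rewrite -/(B n); ring.
apply: (@le_trans _ _ (32 * pi * (C * (4 * N) `^ r * N))).
  by rewrite ler_wpM2l// mulr_ge0// pi_ge0.
rewrite powRM ?(ltW N0)// (_ : N `^ (q - 1) = N `^ r * N); last first.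
  have -> : q - 1 = r + 1 by rewrite /r; ring.
  by rewrite powRD ?powRr1 ?(ltW N0)// (lt0r_neq0 N0) implybT.
by rewrite le_eqVlt; apply/orP; left; apply/eqP; ring.
Qed.

End hausdorff_young_main.

(** * Explicit integrals *)

Section elementary_bounds.
Variable R : realType.

Lemma sin_MVT (x : R) : 0 < x -> exists2 c, 0 < c < x & sin x = cos c * x.
Proof.
move=> x0.
have [c|c] := @MVT R (@sin R) (@cos R) 0 x x0 (fun c _ => is_derive_sin c).
  by apply: continuous_subspaceT; exact: continuous_sin.
by rewrite in_itv/= sin0 !subr0 => cx ->; exists c.
Qed.

Lemma norm_sin_le (x : R) : `|sin x| <= `|x|.
Proof.
wlog x0 : x / 0 <= x => [H|].
  have [/H//|x0] := leP 0 x.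
  by rewrite -normrN -sinN -(normrN x); apply: H; rewrite oppr_ge0 ltW.
move: x0; rewrite le_eqVlt => /predU1P[<-|x0]; first by rewrite sin0 normr0.
have [c _ ->] := sin_MVT x0.
by rewrite normrM ler_piMl// cos_max.
Qed.

Lemma one_sub_cosE (x : R) : 1 - cos x = 2 * sin (x / 2) ^+ 2.
Proof.
have -> : cos x = cos (x / 2 *+ 2) by congr cos; rewrite mulr2n; field.
by rewrite cos_mulr2n sin2cos2 mulr2n; ring.
Qed.

(** By the mean value theorem sin x = x cos c with c in (0, 1), and 1 - cos c = 2 sin(c/2)^2 <=
    c^2/2 <= 1/2. *)
Lemma half_le_sin (x : R) : 0 <= x <= 1 -> x / 2 <= sin x.
Proof.
move=> /andP[]; rewrite le_eqVlt => /predU1P[<- _|x0 x1]; first by rewrite sin0 mul0r.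
have [c /andP[c0 cx] ->] := sin_MVT x0.
have c1 : c <= 1 by rewrite ltW// (lt_le_trans cx).
rewrite mulrC ler_pM2r//.
have := one_sub_cosE c; have : sin (c / 2) ^+ 2 <= (c / 2) ^+ 2.
  by rewrite -(real_normK (num_real (sin _))) -(real_normK (num_real (c / 2)))
    lerXn2r ?nnegrE// norm_sin_le.
have : (c / 2) ^+ 2 <= 1 / 4.
  have -> : (c / 2) ^+ 2 = c ^+ 2 / 4 by field.
  by rewrite ler_pM2r// expr_le1// ltW.
lra.
Qed.

Lemma modulus_expi_sub1 (x : R) : modulus (expi x - 1 : R[i]) = 2 * `|sin (x / 2)|.
Proof.
rewrite modulusE /= (_ : _ + _ = (2 * `|sin (x / 2)|) ^+ 2).
  by rewrite sqrtr_sqr ger0_norm// mulr_ge0.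
rewrite exprMn real_normK ?num_real//.
have -> : (cos x - 1) ^+ 2 + (sin x - 0) ^+ 2 = 2 * (1 - cos x).
  by rewrite subr0 sin2cos2; ring.
by rewrite one_sub_cosE; ring.
Qed.

Lemma modulus_expi_sub1_le (x : R) : modulus (expi x - 1 : R[i]) <= Num.min 2 `|x|.
Proof.
rewrite modulus_expi_sub1 le_min; apply/andP; split.
  by have := sin_max (x / 2); lra.
by have := norm_sin_le (x / 2); rewrite normrM (ger0_norm (_ : 0 <= 2^-1)) ?invr_ge0//; lra.
Qed.

End elementary_bounds.

Section power_integrals.
Variable R : realType.
Local Notation mu := (@completed_lebesgue_measure R).
Local Notation leb := (@lebesgue_measure R).

Lemma cvg_powRN (b : R) : 0 < b -> x `^ (- b) @[x --> +oo] --> (0 : R).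
Proof.
move=> b0; apply/cvgrPdist_le => e e0.
near=> x.
have x0 : 0 < x by near: x; apply: nbhs_pinfty_gt; exact: num_real.
rewrite sub0r normrN ger0_norm ?powR_ge0// powRN -[leRHS]invrK.
rewrite lef_pV2 ?posrE ?powR_gt0 ?invr_gt0//.
have -> : e^-1 = (e^-1 `^ b^-1) `^ b.
  by rewrite -powRrM mulVf ?gt_eqF// powRr1// invr_ge0 ltW.
apply: ge0_ler_powR; rewrite ?nnegrE ?powR_ge0 ?(ltW b0) ?(ltW x0)//.
Unshelve. all: by end_near. Qed.

Lemma integral_powRN (a T : R) : 1 < a -> 0 < T ->
  (\int[leb]_(x in `[T, +oo[) (x `^ (- a))%:E = (T `^ (1 - a) / (a - 1))%:E)%E.
Proof.
move=> a1 T0.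
have a10 : 0 < a - 1 by rewrite subr_gt0.
pose F (x : R) := - (a - 1)^-1 * x `^ (1 - a).
have dF (x : R) : 0 < x -> is_derive x (1 : R) F (x `^ (- a)).
  move=> x0; have := is_derive_mull (- (a - 1)^-1) (is_derive1_powR (1 - a) x0).
  rewrite (_ : 1 - a - 1 = - a); last by ring.
  by rewrite (_ : - (a - 1)^-1 * _ = x `^ (- a))//; field; rewrite gt_eqF.
have cp (c x : R) : 0 < x -> {for x, continuous (fun x => x `^ c)}.
  move=> x0; apply/differentiable_continuous/derivable1_diffP.
  by case: (is_derive1_powR c x0).
rewrite (@ge0_continuous_FTC2y R (fun x => x `^ (- a)) F T 0).
- by rewrite -EFinB; congr EFin; rewrite /F; field; rewrite gt_eqF.
- by move=> x _; rewrite powR_ge0.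
- apply: continuous_in_subspaceT => x; rewrite inE/= in_itv/= andbT => Tx.
  by apply: cp; rewrite (lt_le_trans T0).
- rewrite -[X in _ --> X](mulr0 (- (a - 1)^-1)); apply: cvgMr.
  by rewrite -opprB; exact: cvg_powRN.
- by move=> x Tx; case: (dF x (lt_trans T0 Tx)).
- apply: cvg_at_right_filter; apply/differentiable_continuous/derivable1_diffP.
  by case: (dF T T0).
- move=> x; rewrite in_itv/= andbT => Tx.
  by rewrite derive1E; case: (dF x (lt_trans T0 Tx)).
Qed.

Lemma integral_inv (c T : R) : 1 < T -> 0 <= c ->
  (\int[leb]_(x in `[1%R, T]) (c / x)%:E = (c * ln T)%:E)%E.
Proof.
move=> T1 c0.
have dF (x : R) : 0 < x -> is_derive x (1 : R) (fun x => c * ln x) (c / x).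
  by move=> x0; exact: (is_derive_mull c (is_derive1_ln x0)).
have cF (x : R) : 0 < x -> {for x, continuous (fun x => c * ln x)}.
  by move=> x0; apply/differentiable_continuous/derivable1_diffP; case: (dF x x0).
rewrite (@continuous_FTC2 R (fun x => c / x) (fun x => c * ln x) 1 T T1).
- by rewrite ln1 mulr0 sube0.
- apply: continuous_in_subspaceT => x; rewrite inE/= in_itv/= => /andP[x1 _].
  apply: cvgM; first exact: cvg_cst.
  by apply: inv_continuous; rewrite gt_eqF// (lt_le_trans _ x1).
- split.
  + move=> x; rewrite in_itv/= => /andP[x1 _].
    by case: (dF x (lt_trans ltr01 x1)).
  + exact: cvg_at_right_filter (cF 1 ltr01).
  + exact: cvg_at_left_filter (cF T (lt_trans ltr01 T1)).
- move=> x; rewrite in_itv/= => /andP[x1 _].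
  by rewrite derive1E; case: (dF x (lt_trans ltr01 x1)).
Qed.

(** Folds onto the half-line and passes to the Borel measure at once, where antiderivatives can be
    used. *)
Lemma ge0_even_integral (g : R -> \bar R) : measurable_fun [set: R] g ->
  (forall x, 0 <= g x)%E -> (forall x, g (- x) = g x) ->
  (\int[mu]_x g x = 2%:E * \int[leb]_(x in `[0%R, +oo[) g x)%E.
Proof.
move=> mg g0 ge; rewrite ge0_integral_completed//.
have -> : [set: R] = `]-oo, 0[ `|` `[0, +oo[.
  by apply/seteqP; split=> x //= _; rewrite !in_itv/= andbT; case: (leP 0 x); [right|left].
rewrite ge0_integral_setU//=.
- rewrite integral_itv_bndo_bndc//; last exact: measurable_funTS.
  rewrite (_ : \int[leb]_(x in `]-oo, 0%R]) g x =
      \int[leb]_(x in `]-oo, 0%R]) g (- x)%R)%E; last first.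
    by apply: eq_integral => x _; rewrite ge.
  rewrite -ge0_integration_by_substitution0// -[in LHS](mul1e (integral _ _ _)).
  by rewrite -ge0_muleDl.
- exact: measurable_funTS.
- apply/disj_set2P; apply/seteqP; split=> x //=.
  by rewrite !in_itv/= andbT => -[] x0; rewrite leNgt x0.
Qed.

(** With phi(x) = x^(-2) this is the weight by which [truncF] multiplies f; the other choices of
    [phi] are majorants of its powers and of its increments. *)
Definition outside_unit (phi : R -> R) : R -> R :=
  fun t => if `|t| <= 1 then 0 else phi `|t|.

Lemma measurable_outside_unit (phi : R -> R) : measurable_fun [set: R] phi ->
  measurable_fun [set: R] (outside_unit phi).
Proof.
move=> mphi; apply: measurable_fun_if => //.
- by apply: measurable_fun_ler => //; exact: measurable_cst.
- by apply: measurable_funTS; exact: measurableT_comp.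
Qed.

Lemma integral_outside_unit_le (phi : R -> R) : measurable_fun [set: R] phi ->
  (forall x, 0 <= phi x) ->
  (\int[mu]_t (outside_unit phi t)%:E <=
   2%:E * \int[leb]_(x in `[1%R, +oo[) (phi x)%:E)%E.
Proof.
move=> mphi phi0; have mo := measurable_outside_unit mphi.
have o0 x : 0 <= outside_unit phi x by rewrite /outside_unit; case: ifP.
rewrite ge0_even_integral.
- rewrite lee_pmul2l//; rewrite integral_mkcond [leRHS]integral_mkcond.
  apply: ge0_le_integral => //.
  + by move=> x _; apply: erestrict_ge0 => y _; rewrite lee_fin.
  + apply/(measurable_restrictT _ (measurable_itv _)).
    by apply: measurable_funTS; apply/measurable_EFinP.
  + apply/(measurable_restrictT _ (measurable_itv _)).
    by apply: measurable_funTS; apply/measurable_EFinP.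
  + move=> x _; rewrite !patchE; case: ifPn => [|_]; last first.
      by case: ifPn => // _; rewrite lee_fin.
    rewrite inE/= in_itv/= andbT => x0; rewrite /outside_unit (ger0_norm x0).
    case: ifPn => [_|]; first by case: ifPn => // _; rewrite lee_fin.
    by rewrite -ltNge => x1; rewrite ifT// inE/= in_itv/= andbT ltW.
- exact/measurable_EFinP.
- by move=> x; rewrite lee_fin.
- by move=> x; rewrite /outside_unit normrN.
Qed.

Lemma integral_outside_unit_powR (a : R) : 1 < a ->
  (\int[mu]_t (outside_unit (fun x => x `^ (- a)) t)%:E <= (2 / (a - 1))%:E)%E.
Proof.
move=> a1; apply: le_trans (integral_outside_unit_le _ _) _.
- exact: measurable_powR.
- by move=> x; exact: powR_ge0.
- by rewrite integral_powRN// -EFinM powR1 mul1r.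
Qed.

Lemma integral_outside_unit_log (h : R) : 0 < h < 1 ->
  (\int[mu]_t (outside_unit (fun x => Num.min 2 (h * x) * x `^ (- 2)) t)%:E <=
   (2 * (h * (- ln h) + 2 * h))%:E)%E.
Proof.
move=> /andP[h0 h1].
(* The maximum with 0 changes nothing for positive x, but makes the function nonnegative on the
   whole line. *)
pose phi (x : R) := Num.max 0 (Num.min 2 (h * x)) * x `^ (- 2).
have mphi : measurable_fun [set: R] phi.
  apply: measurable_funM; last exact: measurable_powR.
  apply: measurable_maxr; first exact: measurable_cst.
  apply: measurable_minr; first exact: measurable_cst.
  by apply: measurable_funM => //; exact: measurable_cst.
have phi0 x : 0 <= phi x by rewrite mulr_ge0 ?powR_ge0// le_max lexx.
have -> : outside_unit (fun x => Num.min 2 (h * x) * x `^ (- 2)) = outside_unit phi.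
  apply/funext => t; rewrite /outside_unit; case: ifP => // _; rewrite /phi max_r//.
  by rewrite le_min ler0n mulr_ge0// ltW.
apply: le_trans (integral_outside_unit_le mphi phi0) _.
rewrite EFinM lee_pmul2l//.
(* The two arguments of the minimum cross at 2/h. Splitting at 1/h is cruder, but it gives exactly h
   ln(1/h) from h/x below and 2h from 2/x^2 above. *)
have hV : 1 < h^-1 by rewrite invf_gt1.
have -> : `[1%R, +oo[%classic = `[1, h^-1[ `|` `[h^-1, +oo[.
  apply/seteqP; split=> x /=; rewrite !in_itv/= !andbT.
    by move=> ->; case: (leP h^-1 x); [right|left].
  by move=> [/andP[]//|/(le_trans (ltW hV))].
rewrite ge0_integral_setU//=; last 3 first.
- exact/measurable_EFinP/measurable_funTS.
- by move=> x _; rewrite lee_fin.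
- apply/disj_set2P; apply/seteqP; split=> x //=.
  by rewrite !in_itv/= andbT => -[/andP[_ x0]]; rewrite leNgt x0.
rewrite EFinD; apply: leeD.
- rewrite integral_itv_bndo_bndc; last exact/measurable_EFinP/measurable_funTS.
  rewrite -lnV ?posrE// -(integral_inv hV (ltW h0)).
  apply: ge0_le_integral => //.
  + by move=> x _; rewrite lee_fin.
  + exact/measurable_EFinP/measurable_funTS.
  + apply/measurable_EFinP; apply: measurable_funM; first exact: measurable_cst.
    apply: subspace_continuous_measurable_fun; first exact: measurable_itv.
    apply: continuous_in_subspaceT => x; rewrite inE/= in_itv/= => /andP[x1 _].
    by apply: inv_continuous; rewrite gt_eqF// (lt_le_trans _ x1).
  + move=> x; rewrite /= in_itv/= => /andP[x1 _]; rewrite lee_fin.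
    have x0 : 0 < x by rewrite (lt_le_trans _ x1).
    rewrite /phi max_r; last by rewrite le_min ler0n mulr_ge0// ltW.
    rewrite powRN powR_mulrn ?(ltW x0)// ler_pdivrMr ?exprn_gt0//.
    by rewrite (_ : h / x * x ^+ 2 = h * x) ?ge_min ?lexx ?orbT//; field; rewrite gt_eqF.
- rewrite (_ : 2 * h = 2 * (h^-1 `^ (1 - 2) / (2 - 1))); last first.
    by rewrite (_ : 1 - 2 = -1) ?powR_inv1 ?invrK ?invr_ge0 ?(ltW h0)//; [field|ring].
  rewrite EFinM -integral_powRN// ?ltr1n ?invr_gt0//.
  rewrite -ge0_integralZl_EFin//; last 2 first.
  + by move=> x _; rewrite lee_fin powR_ge0.
  + by apply/measurable_EFinP/measurable_funTS; exact: measurable_powR.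
  apply: ge0_le_integral => //.
  + by move=> x _; rewrite lee_fin.
  + exact/measurable_EFinP/measurable_funTS.
  + apply/measurable_EFinP; apply: measurable_funM; first exact: measurable_cst.
    by apply: measurable_funTS; exact: measurable_powR.
  + move=> x _; rewrite -EFinM lee_fin ler_wpM2r ?powR_ge0//.
    by rewrite ge_max ler0n ge_min lexx.
Qed.

End power_integrals.

(** * The truncated function and its transform *)

Section truncated_function.
Variable R : realType.
Local Notation mu := (@completed_lebesgue_measure R).
Local Notation lebesgueR := (caratheodory_type (@wlength R idfun)^*%mu).
Implicit Types (f G : R -> R[i]).

(** The norm of exponent +oo is the essential supremum only when the total mass is positive;
    otherwise it takes a default value. *)
Lemma completed_lebesgue_setT_gt0 : (0 < mu [set: R])%E.
Proof.
apply: (@lt_le_trans _ _ (mu `[0%R, 1%R]%classic)).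
  by rewrite completed_lebesgue_measureE// lebesgue_measure_itv/= lte01 oppr0 adde0 lte_fin.
apply: le_measure; rewrite ?inE//.
by apply: borel_lebesgue_measurable; exact: measurable_itv.
Qed.

Lemma lnorm_ooE G :
  lnorm +oo%E G = ess_sup mu (fun x => (modulus (G x))%:E).
Proof.
rewrite /lnorm unlock ifT; last exact: completed_lebesgue_setT_gt0.
congr ess_sup.
by apply/funext => x /=; rewrite ger0_norm ?modulus_ge0.
Qed.

Lemma lnorm_finE (r : R) G :
  lnorm r%:E G = ((\int[mu]_x (modulus (G x) `^ r)%:E) `^ r^-1)%E.
Proof.
rewrite /lnorm unlock.
by under eq_integral do rewrite abse_EFin poweR_EFin (ger0_norm (modulus_ge0 _)).
Qed.

Lemma lnorm_1E G : lnorm 1%E G = (\int[mu]_x (modulus (G x))%:E)%E.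
Proof.
rewrite /lnorm Lnorm1; apply: eq_integral => x _ /=.
by rewrite ger0_norm ?modulus_ge0.
Qed.

(** The essential supremum bounds f only off a null set, so later comparisons of integrands hold
    almost everywhere. *)
Lemma in_Loo_ae_bound f : in_L +oo%E f -> exists2 k : R, 0 <= k &
  lnorm +oo%E f = k%:E /\ {ae mu, forall x, modulus (f x) <= k}.
Proof.
move=> [mf fy]; have f0 := Lnorm_ge0 mu +oo%E (fun x => (modulus (f x))%:E).
have ffin : lnorm +oo%E f \is a fin_num by rewrite ge0_fin_numE.
exists (fine (lnorm +oo%E f)); first exact: fine_ge0.
split; first by rewrite fineK.
have := @ess_sup_ge _ lebesgueR R mu (fun x => (modulus (f x))%:E).
rewrite -lnorm_ooE -(fineK ffin).
by apply: filterS => x; rewrite lee_fin.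
Qed.

Local Notation w := (outside_unit (fun x : R => x `^ (- 2))).

Lemma measurable_outside_unit_powR (a : R) :
  measurable_fun [set: lebesgueR] (outside_unit (fun x : R => x `^ (- a))).
Proof.
apply: borel_measurable_fun; first exact: measurableT.
by apply: measurable_outside_unit; exact: measurable_powR.
Qed.

Lemma truncFE f t : truncF f t = (w t)%:C * f t.
Proof.
rewrite /truncF /outside_unit; case: ifPn => [_|]; first by rewrite mul0r.
rewrite -ltNge => t1; rewrite powRN powR_mulrn// real_normK ?num_real//.
by rewrite mulrC; congr (_ * _); rewrite fmorphV.
Qed.

Lemma outside_unit_ge0 (a t : R) : 0 <= outside_unit (fun x => x `^ (- a)) t.
Proof. by rewrite /outside_unit; case: ifP => // _; exact: powR_ge0. Qed.

Lemma modulus_truncF f t : modulus (truncF f t) = w t * modulus (f t).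
Proof. by rewrite truncFE modulusM modulus_real ger0_norm// outside_unit_ge0. Qed.

Lemma lebesgue_measurable_truncF f : lebesgue_measurable f ->
  lebesgue_measurable (truncF f).
Proof.
move=> mf; rewrite (_ : truncF f = (fun t => (w t)%:C * f t)).
  apply: (lebesgue_measurableM _ mf); apply: lebesgue_measurable_real.
  exact: measurable_outside_unit_powR.
by apply/funext => t; rewrite truncFE.
Qed.

Lemma outside_unit_powRM (r t : R) : r != 0 ->
  w t `^ r = outside_unit (fun x => x `^ (- (2 * r))) t.
Proof.
move=> r0; rewrite /outside_unit; case: ifP => _; first by rewrite powR0.
by rewrite -powRrM mulNr.
Qed.

(** The r-th power of |F| is at most k^r |t|^(-2r) almost everywhere outside [-1, 1], and 2r > 1 is
    the condition for this majorant to be integrable at infinity. *)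
Lemma integral_truncF_powR f (r : R) : 2^-1 < r -> in_L +oo%E f ->
  (\int[mu]_x (modulus (truncF f x) `^ r)%:E < +oo)%E.
Proof.
move=> r2 Lf; have [k k0 [_ fk]] := in_Loo_ae_bound Lf.
have r0 : 0 < r by apply: lt_trans r2; rewrite invr_gt0.
have a1 : 1 < 2 * r by rewrite -ltr_pdivrMl// mulr1.
have mo := measurable_outside_unit_powR (2 * r).
have H x : modulus (f x) <= k -> ((modulus (truncF f x) `^ r)%:E <=
    (k `^ r * outside_unit (fun x => x `^ (- (2 * r))) x)%:E)%E.
  move=> fxk; rewrite lee_fin modulus_truncF.
  rewrite powRM ?modulus_ge0 ?outside_unit_ge0// mulrC outside_unit_powRM ?gt_eqF//.
  rewrite ler_wpM2r ?outside_unit_ge0//.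
  by apply: ge0_ler_powR; rewrite ?nnegrE ?modulus_ge0// ltW.
apply: (@le_lt_trans _ _ (\int[mu]_x
    (k `^ r * outside_unit (fun x => x `^ (- (2 * r))) x)%:E)%E).
  apply: (@ae_ge0_le_integral _ lebesgueR R mu setT measurableT).
  - by move=> x _; rewrite lee_fin powR_ge0.
  - apply/measurable_EFinP; apply: measurable_modulus_powR.
    exact: lebesgue_measurable_truncF Lf.1.
  - by move=> x _; rewrite lee_fin mulr_ge0 ?powR_ge0// outside_unit_ge0.
  - by apply/measurable_EFinP; apply: measurable_funM; first exact: measurable_cst.
  - have [N [mN N0 fN]] := fk; exists N; split => //; apply: subset_trans fN => x.
    by apply: contra_not => fxk _; exact: H.
under eq_integral do rewrite EFinM.
have moE : measurable_fun [set: lebesgueR]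
  (fun x => (outside_unit (fun x => x `^ (- (2 * r))) x)%:E) by exact/measurable_EFinP.
rewrite (@ge0_integralZl_EFin _ lebesgueR R mu setT measurableT _ _ moE _ (powR_ge0 _ _)).
- rewrite lte_mul_pinfty ?lee_fin ?powR_ge0//.
  by apply: le_lt_trans (integral_outside_unit_powR a1) _; exact: ltry.
- by move=> x _; rewrite lee_fin outside_unit_ge0.
Qed.

Lemma truncF_in_L f (r : \bar R) : (2^-1%:E < r)%E -> in_L +oo%E f ->
  in_L r (truncF f).
Proof.
move=> r2 Lf; split; first exact: lebesgue_measurable_truncF Lf.1.
case: r r2 => [r||//] r2.
  by rewrite lnorm_finE poweR_lty// integral_truncF_powR// -lte_fin.
apply: le_lt_trans Lf.2; rewrite !lnorm_ooE; apply: le_ess_sup.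
apply: nearW => x; rewrite lee_fin modulus_truncF ler_piMl ?modulus_ge0//.
rewrite /outside_unit; case: ifPn => // x1; rewrite -ltNge in x1.
by rewrite powRN powR_mulrn// invf_le1 ?exprn_gt0 ?expr_ge1 ?(ltW x1)// (lt_trans _ x1).
Qed.

Lemma cintegrable_truncF f : in_L +oo%E f -> cintegrable (truncF f).
Proof.
move=> Lf; apply: cintegrable_norm_lty; first exact: lebesgue_measurable_truncF Lf.1.
have := @integral_truncF_powR f 1; rewrite invf_lt1// ltr1n => /(_ isT Lf).
by under eq_integral do rewrite powRr1 ?modulus_ge0//.
Qed.

Lemma integrable_sqr_truncF f : in_L +oo%E f ->
  mu.-integrable setT (EFin \o (fun t => modulus (truncF f t) ^+ 2)).
Proof.
move=> Lf; apply/integrableP; split.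
  apply/measurable_EFinP; apply: measurable_sqr_modulus.
  exact: lebesgue_measurable_truncF Lf.1.
under eq_integral do rewrite /= ger0_norm ?sqr_ge0// -powR_mulrn ?modulus_ge0//.
by apply: integral_truncF_powR => //; lra.
Qed.

Lemma lnorm_oo_fourier_le G : cintegrable G ->
  (lnorm +oo%E (fourier G) <= lnorm 1%E G)%E.
Proof.
move=> iG; rewrite lnorm_ooE lnorm_1E; apply/ess_supP; apply: nearW => s.
apply: le_trans (modulus_cintegral_le_integral (cintegrable_expiM s iG)) _.
rewrite le_eqVlt; apply/orP; left; apply/eqP; apply: eq_integral => x _.
by rewrite modulusM modulus_expi mul1r.
Qed.

Lemma Psi_in_L f (q : \bar R) : (2%:E <= q)%E -> in_L +oo%E f -> in_L q (Psi f).
Proof.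
move=> q2 Lf; have iF := cintegrable_truncF Lf.
split; first exact: lebesgue_measurable_fourier.
case: q q2 => [q||//] q2; last first.
  apply: le_lt_trans (lnorm_oo_fourier_le iF) _.
  apply: (truncF_in_L _ Lf).2; rewrite lte_fin; lra.
rewrite lnorm_finE poweR_lty//; rewrite lee_fin in q2.
have := integrable_fourier_powR q2 iF (integrable_sqr_truncF Lf).
move=> /integrableP[_]; apply: le_lt_trans; rewrite le_eqVlt; apply/orP; left.
by apply/eqP; apply: eq_integral => x _ /=; rewrite ger0_norm ?powR_ge0.
Qed.

Lemma hausdorff_young_lnorm (p q : R) : 1 < p -> p < 2 -> 2 < q ->
  p^-1 + q^-1 = 1 -> exists C : R, forall G, cintegrable G ->
    mu.-integrable setT (EFin \o (fun t => modulus (G t) ^+ 2)) ->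
    (lnorm q%:E (fourier G) <= C%:E * lnorm p%:E G)%E.
Proof.
move=> p1 p2 q2 pq; have [K K0 HK] := hausdorff_young_power p1 p2 q2 pq.
have p0 : 0 < p by rewrite (lt_trans _ p1).
have q0 : 0 < q by rewrite (lt_trans _ q2).
exists (K `^ q^-1) => G iG iG2.
have iGp : mu.-integrable setT (EFin \o (fun t => modulus (G t) `^ p)).
  by apply: integrable_modulus_powR => //; rewrite !ltW.
have iFq := integrable_fourier_powR (ltW q2) iG iG2.
set N := Rintegral mu setT (fun t => modulus (G t) `^ p).
set I := Rintegral mu setT (fun s => modulus (fourier G s) `^ q).
have NE : (\int[mu]_t (modulus (G t) `^ p)%:E = N%:E)%E.
  exact: esym (fineK (integrable_fin_num measurableT iGp)).
have IE : (\int[mu]_s (modulus (fourier G s) `^ q)%:E = I%:E)%E.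
  exact: esym (fineK (integrable_fin_num measurableT iFq)).
rewrite !lnorm_finE NE IE (poweR_EFin I) (poweR_EFin N) -EFinM lee_fin.
have {}HK n : 0 < n -> N <= n -> I <= K * n `^ (q - 1) by exact: HK.
have I0 : 0 <= I by apply: Rintegral_ge0 => x _; exact: powR_ge0.
have NN : 0 <= N by apply: Rintegral_ge0 => x _; exact: powR_ge0.
clear NE IE; clearbody I N.
have q10 : 0 < q - 1 by rewrite subr_gt0 (lt_trans _ q2)// ltr1n.
(* When [N] is 0 the power bound holds for every positive bound n. If [I] were positive, the choice
   of n with K n^(q-1) = I/2 would be contradictory. *)
move: NN; rewrite le_eqVlt => /predU1P[N0|N0].
  suff -> : I = 0 by rewrite powR0 ?invr_neq0 ?gt_eqF// mulr_ge0 ?powR_ge0.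
  apply/eqP; rewrite eq_le I0 andbT leNgt; apply/negP => {}I0.
  have e0 : 0 < (I / (2 * K)) `^ (q - 1)^-1 by rewrite powR_gt0// divr_gt0// mulr_gt0.
  have := HK _ e0; rewrite -N0 => /(_ (ltW e0)).
  rewrite -powRrM mulVf ?gt_eqF// powRr1; last first.
    by rewrite ltW// divr_gt0// mulr_gt0.
  have -> : K * (I / (2 * K)) = I / 2 by field; rewrite gt_eqF.
  lra.
apply: (@le_trans _ _ ((K * N `^ (q - 1)) `^ q^-1)).
  apply: ge0_ler_powR; rewrite ?nnegrE ?invr_ge0 ?(ltW q0)//.
    by rewrite mulr_ge0 ?powR_ge0// ltW.
  exact: HK.
rewrite powRM ?(ltW K0) ?powR_ge0// -powRrM.
rewrite (_ : (q - 1) * q^-1 = p^-1)//.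
by rewrite mulrBl mulfV ?gt_eqF// mul1r -pq addrK.
Qed.

Lemma plancherel_lnorm G : cintegrable G ->
  mu.-integrable setT (EFin \o (fun t => modulus (G t) ^+ 2)) ->
  (lnorm 2%:E (fourier G) <= ((2 * pi) `^ 2^-1)%:E * lnorm 2%:E G)%E.
Proof.
move=> iG iG2; have [iF FG] := plancherel_le iG iG2.
set N := Rintegral mu setT (fun t => modulus (G t) ^+ 2) in FG *.
set I := Rintegral mu setT (fun s => modulus (fourier G s) ^+ 2) in FG *.
have NE : (\int[mu]_t (modulus (G t) `^ 2)%:E = N%:E)%E.
  under eq_integral do rewrite (powR_mulrn _ (modulus_ge0 _)).
  exact: esym (fineK (integrable_fin_num measurableT iG2)).
have IE : (\int[mu]_s (modulus (fourier G s) `^ 2)%:E = I%:E)%E.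
  under eq_integral do rewrite (powR_mulrn _ (modulus_ge0 _)).
  exact: esym (fineK (integrable_fin_num measurableT iF)).
rewrite !lnorm_finE NE IE (poweR_EFin I) (poweR_EFin N) -EFinM lee_fin.
rewrite -powRM ?mulr_ge0 ?pi_ge0//; last first.
  by apply: Rintegral_ge0 => x _; exact: sqr_ge0.
apply: ge0_ler_powR; rewrite ?nnegrE ?invr_ge0//.
- by apply: Rintegral_ge0 => x _; exact: sqr_ge0.
- rewrite mulr_ge0 ?mulr_ge0 ?pi_ge0//.
  by apply: Rintegral_ge0 => x _; exact: sqr_ge0.
Qed.

(** The constant is chosen before q, as it may depend on p alone; this is harmless because p
    determines its conjugate. Conjugacy with q >= 2 forces 1 <= p <= 2: the ends are the sup bound
    and the L^2 bound, and for any other p the claim is vacuous, with constant 0. *)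
Lemma hausdorff_young_constant (p : \bar R) : exists C : R, forall q : \bar R,
  (2%:E <= q)%E -> (p^-1 + q^-1 = 1)%E ->
  forall f, in_L +oo%E f -> (lnorm q (Psi f) <= C%:E * lnorm p (truncF f))%E.
Proof.
have [->|p1] := eqVneq p 1%E.
  exists 1 => q q2; rewrite inve1 => q1 f Lf; rewrite mul1e.
  have -> : q = +oo%E.
    case: q q2 q1 => [q||//] // q2; rewrite inver; rewrite lee_fin in q2.
    have q0 : 0 < q by rewrite (lt_le_trans _ q2).
    rewrite gt_eqF// -EFinD => -[] /eqP; rewrite -subr_eq0 addrAC subrr add0r.
    by rewrite invr_eq0 gt_eqF.
  exact: lnorm_oo_fourier_le (cintegrable_truncF Lf).
case: p p1 => [p||] p1; last 2 first.
- exists 0 => q q2; case: q q2 => [q||//] q2.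
    rewrite invey add0e inver; rewrite lee_fin in q2.
    have q0 : 0 < q by rewrite (lt_le_trans _ q2).
    rewrite gt_eqF// => -[] /eqP; rewrite invr_eq1 => /eqP q1.
    by move: q2; rewrite q1 leNgt ltr1n.
  by rewrite invey adde0 => /eqP; rewrite eq_sym onee_eq0.
- exists 0 => q q2; rewrite inveNy; case: q q2 => [q||//] q2; last by rewrite invey.
  by rewrite inver; case: ifP.
have [->|p2] := eqVneq p 2.
  exists ((2 * pi) `^ 2^-1) => q q2; case: q q2 => [q||//] q2; last first.
    rewrite inver pnatr_eq0/= invey adde0 => -[] /eqP.
    by rewrite invr_eq1 pnatr_eq1.
  rewrite !inver pnatr_eq0/=; rewrite lee_fin in q2.
  have q0 : 0 < q by rewrite (lt_le_trans _ q2).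
  rewrite gt_eqF// -EFinD => -[] q22 f Lf.
  have -> : q = 2 by apply: invr_inj; lra.
  exact: plancherel_lnorm (cintegrable_truncF Lf) (integrable_sqr_truncF Lf).
have [pp|pp] := boolP ((1 < p) && (p < 2)); last first.
  exists 0 => q q2; case: q q2 => [q||//] q2; last first.
    rewrite inver; case: ifPn => // p0; rewrite invey adde0 => -[] /eqP.
    by rewrite invr_eq1 => /eqP p11; move: p1; rewrite p11 eqxx.
  rewrite !inver; case: ifPn => [_|p0]; first by case: ifP.
  rewrite lee_fin in q2.
  have q0 : 0 < q by rewrite (lt_le_trans _ q2).
  rewrite gt_eqF// -EFinD => -[] pq; exfalso; move/negP: pp; apply.
  have qV0 : 0 < q^-1 by rewrite invr_gt0.
  have qV2 : q^-1 <= 2^-1 by rewrite lef_pV2 ?posrE.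
  have pV0 : 0 < p^-1 by lra.
  have {}p0 : 0 < p by rewrite -invr_gt0.
  have h1 : 1 < p by rewrite -[p]invrK invf_gt1//; lra.
  rewrite h1 lt_neqAle p2 -(invrK p) -[leRHS]invrK lef_pV2 ?posrE//; lra.
move/andP: pp => [pp1 pp2]; pose q0 := (1 - p^-1)^-1.
have p0 : 0 < p by rewrite (lt_trans _ pp1).
have pV1 : p^-1 < 1 by rewrite invf_lt1.
have pV2 : 2^-1 < p^-1 by rewrite ltf_pV2 ?posrE.
have q02 : 2 < q0 by rewrite /q0 -(invrK 2) ltf_pV2 ?posrE; lra.
have pq0 : p^-1 + q0^-1 = 1 by rewrite /q0 invrK; ring.
have [C HC] := hausdorff_young_lnorm pp1 pp2 q02 pq0.
exists C => q q2; case: q q2 => [q||//] q2; last first.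
  rewrite inver gt_eqF// invey adde0 => -[] /eqP.
  by rewrite invr_eq1 => /eqP p11; move: p1; rewrite p11 eqxx.
rewrite !inver; rewrite lee_fin in q2.
have q00 : 0 < q by rewrite (lt_le_trans _ q2).
rewrite !gt_eqF// -EFinD => -[] pq f Lf.
have -> : q = q0 by apply: invr_inj; lra.
exact: HC (cintegrable_truncF Lf) (integrable_sqr_truncF Lf).
Qed.

End truncated_function.

(** * Modulus of continuity and decay of the transform *)

Section regularity.
Variable R : realType.
Local Notation mu := (@completed_lebesgue_measure R).
Local Notation lebesgueR := (caratheodory_type (@wlength R idfun)^*%mu).
Local Notation absc := (@ComplexField.Normc.normc R).
Implicit Types (f G : R -> R[i]).

Lemma fourier_increment G (s h : R) : cintegrable G ->
  fourier G (s + h) - fourier G s =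
  cintegral setT (fun t => (expi (- (h * t)) - 1) * (expi (- (s * t)) * G t)).
Proof.
move=> iG; rewrite /fourier.
rewrite -(cintegralB (cintegrable_expiM (s + h) iG) (cintegrable_expiM s iG)).
apply: eq_cintegral => t.
rewrite (_ : - ((s + h) * t) = - (h * t) + - (s * t)); last by ring.
by rewrite expiD mulrBl mul1r mulrA.
Qed.

Lemma cintegrable_increment G (s h : R) : cintegrable G ->
  cintegrable (fun t => (expi (- (h * t)) - 1) * (expi (- (s * t)) * G t)).
Proof.
move=> iG; apply: (@cintegrableM_bounded _ _ _ 2) (cintegrable_expiM s iG).
- exact: lebesgue_measurableD (lebesgue_measurable_expi h) (lebesgue_measurable_cst (-1)).
- by move=> t; apply: le_trans (modulus_expi_sub1_le _) _; rewrite ge_min lexx.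
Qed.

Lemma modulus_fourier_increment_le G (s h : R) : cintegrable G ->
  ((modulus (fourier G (s + h) - fourier G s))%:E <=
   \int[mu]_t (Num.min 2 `|h * t| * modulus (G t))%:E)%E.
Proof.
move=> iG; rewrite fourier_increment//.
have iI := cintegrable_increment s h iG.
apply: le_trans (modulus_cintegral_le_integral iI) _.
apply: (@ge0_le_integral _ lebesgueR R mu setT measurableT).
- by move=> t _; rewrite lee_fin modulus_ge0.
- exact: measurable_int (cintegrable_modulus iI).
- apply/measurable_EFinP; apply: measurable_funM.
    apply: measurable_minr; first exact: measurable_cst.
    apply: continuous_lebesgue_measurable => t.
    apply: continuous_comp; first exact: mulrl_continuous.
    exact: norm_continuous.
  exact: measurable_modulus (cintegrable_measurable iG).
- move=> t _; rewrite lee_fin !modulusM modulus_expi mul1r ler_wpM2r ?modulus_ge0//.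
  by rewrite -(normrN (h * t)) modulus_expi_sub1_le.
Qed.

Lemma modulus_Psi_increment_le f (k s h : R) : in_L +oo%E f -> 0 <= k ->
  {ae mu, forall x, modulus (f x) <= k} -> 0 < `|h| < 1 ->
  modulus (Psi f (s + h) - Psi f s) <= k * (2 * (`|h| * (- ln `|h|) + 2 * `|h|)).
Proof.
move=> Lf k0 fk h01; have iF := cintegrable_truncF Lf.
rewrite -lee_fin; apply: le_trans (modulus_fourier_increment_le s h iF) _.
pose o := outside_unit (fun x => Num.min 2 (`|h| * x) * x `^ (- 2)).
have mo : measurable_fun [set: lebesgueR] o.
  apply: borel_measurable_fun; first exact: measurableT.
  apply: measurable_outside_unit; apply: measurable_funM; last exact: measurable_powR.
  apply: measurable_minr; first exact: measurable_cst.
  by apply: measurable_funM => //; exact: measurable_cst.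
have o0 t : 0 <= o t.
  by rewrite /o /outside_unit /=; case: ifP => // _; rewrite mulr_ge0.
have H t : modulus (f t) <= k ->
    ((Num.min 2 `|h * t| * modulus (truncF f t))%:E <= (k * o t)%:E)%E.
  move=> ftk; rewrite lee_fin modulus_truncF /o /outside_unit normrM /=.
  case: ifP => _; first by rewrite mul0r !mulr0.
  by rewrite mulrA [leRHS]mulrC ler_wpM2l// mulr_ge0 ?powR_ge0.
have mko : measurable_fun [set: lebesgueR] (fun t => (o t)%:E) by exact/measurable_EFinP.
apply: (@le_trans _ _ (\int[mu]_t (k * o t)%:E)%E).
  apply: (@ae_ge0_le_integral _ lebesgueR R mu setT measurableT).
  - by move=> t _; rewrite lee_fin mulr_ge0 ?modulus_ge0.
  - apply/measurable_EFinP; apply: measurable_funM.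
      apply: measurable_minr; first exact: measurable_cst.
      apply: continuous_lebesgue_measurable => t.
      apply: continuous_comp; first exact: mulrl_continuous.
      exact: norm_continuous.
    exact: measurable_modulus (cintegrable_measurable iF).
  - by move=> t _; rewrite lee_fin mulr_ge0.
  - by apply/measurable_EFinP; apply: measurable_funM; first exact: measurable_cst.
  - have [N [mN N0 fN]] := fk; exists N; split => //; apply: subset_trans fN => t.
    by apply: contra_not => ftk _; exact: H.
under eq_integral do rewrite EFinM.
rewrite (@ge0_integralZl_EFin _ lebesgueR R mu setT measurableT _ _ mko _ k0).
  by rewrite [leRHS]EFinM lee_wpmul2l// integral_outside_unit_log.
by move=> t _; rewrite lee_fin.
Qed.

Lemma norm_ln_small (h : R) : 0 < `|h| < (expR 1)^-1 ->
  [/\ `|h| < 1, 1 <= - ln `|h| & `|ln `|h| | = - ln `|h|].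
Proof.
move=> /andP[h0 h1]; have e1 : (expR 1)^-1 < 1 :> R.
  by rewrite invf_lt1 ?expR_gt0// expR_gt1.
have l1 : 1 <= - ln `|h|; last first.
  by split=> //; [exact: lt_trans e1|rewrite ler0_norm// -oppr_ge0 (le_trans _ l1)].
rewrite lerNr -[leRHS](@expRK R) expRN ler_ln ?posrE ?invr_gt0 ?expR_gt0//.
exact: ltW.
Qed.

Lemma Psi_log_modulus f (h s : R) : in_L +oo%E f -> 0 < `|h| < (expR 1)^-1 ->
  ((modulus (Psi f (s + h) - Psi f s))%:E <=
   6%:E * lnorm +oo%E f * (`|h| * `|ln `|h| |)%:E)%E.
Proof.
move=> Lf h0; have [k k0 [-> fk]] := in_Loo_ae_bound Lf.
have [h1 l1 lE] := norm_ln_small h0; have /andP[hp _] := h0.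
rewrite -!EFinM lee_fin.
have h01 : 0 < `|h| < 1 by rewrite hp h1.
apply: le_trans (modulus_Psi_increment_le s Lf k0 fk h01) _.
rewrite lE.
rewrite [6 * k]mulrC -mulrA ler_wpM2l//.
(* The condition |h| < 1/e makes the logarithm at least 1 in modulus, so the linear term 2|h| is
   absorbed and the constant is 2 (1 + 2) = 6. *)
have : `|h| * 1 <= `|h| * - ln `|h| by rewrite ler_pM2l.
lra.
Qed.

Lemma Psi_bounded f : in_L +oo%E f ->
  exists2 M : R, 0 <= M & forall s, modulus (Psi f s) <= M.
Proof.
move=> Lf; exists (Rintegral mu setT (absc \o truncF f)).
  by apply: Rintegral_ge0 => x _; exact: modulus_ge0.
by move=> s; exact: modulus_fourier_le (cintegrable_truncF Lf).
Qed.

Lemma ln_le_powR (y b : R) : 0 < y -> 0 < b -> ln y <= y `^ b / b.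
Proof.
move=> y0 b0; rewrite ler_pdivlMr// mulrC -ln_powR ltW// ln_sublinear//.
exact: powR_gt0.
Qed.

(** The constant adds up two regimes. For |h| < 1/e the logarithm is at most |h|^(alpha-1) / (1 -
    alpha). For larger |h| the increment is at most 2M, while |h|^alpha is at least 1/e. *)
Lemma Psi_holder f (alpha : R) : in_L +oo%E f -> 0 < alpha < 1 ->
  holder alpha (Psi f).
Proof.
move=> Lf /andP[a0 a1]; have [k k0 [kE fk]] := in_Loo_ae_bound Lf.
have [M M0 PM] := Psi_bounded Lf.
have b0 : 0 < 1 - alpha by rewrite subr_gt0.
exists (6 * k / (1 - alpha) + 2 * M * expR 1) => h s.
have c1 : 0 <= 6 * k / (1 - alpha) by rewrite divr_ge0 ?mulr_ge0// ltW.
have c2 : 0 <= 2 * M * expR 1 by rewrite !mulr_ge0// expR_ge0.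
have [->|h0] := eqVneq h 0.
  by rewrite addr0 subrr modulus0 mulr_ge0 ?powR_ge0// addr_ge0.
have hp : 0 < `|h| by rewrite normr_gt0.
rewrite mulrDl; have [hs|hl] := ltP `|h| (expR 1)^-1; last first.
  apply: ler_wpDl; first by rewrite mulr_ge0 ?powR_ge0.
  apply: (@le_trans _ _ (2 * M)).
    by apply: le_trans (modulusB _ _) _; have := PM (s + h); have := PM s; lra.
  rewrite -mulrA ler_peMr ?mulr_ge0//.
  rewrite -ler_pdivrMl ?expR_gt0// mulr1.
  have e01 : (0 < (expR 1 : R)^-1) && ((expR 1 : R)^-1 <= 1).
    apply/andP; split; first by rewrite invr_gt0 expR_gt0.
    by rewrite invf_le1 ?expR_gt0// ltW// expR_gt1.
  apply: (@le_trans _ _ ((expR 1)^-1 `^ alpha)).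
    exact: ger1_powR e01 (ltW a1).
  by apply: ge0_ler_powR; rewrite ?nnegrE ?invr_ge0 ?expR_ge0// ltW.
apply: ler_wpDr; first by rewrite mulr_ge0 ?powR_ge0.
have h01 : 0 < `|h| < (expR 1)^-1 by rewrite hp hs.
have := Psi_log_modulus s Lf h01; rewrite kE -!EFinM lee_fin => /le_trans; apply.
have [h1 l1 lE] := norm_ln_small h01.
rewrite lE.
rewrite -[leRHS]mulrA ler_wpM2l ?mulr_ge0// -lnV ?posrE//.
have hV0 : 0 < `|h|^-1 by rewrite invr_gt0.
apply: (@le_trans _ _ (`|h| * (`|h|^-1 `^ (1 - alpha) / (1 - alpha)))).
  by rewrite ler_pM2l// ln_le_powR.
rewrite mulrA [leRHS]mulrC ler_pM2r ?invr_gt0//.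
rewrite -(powR_inv1 (ltW hp)) -powRrM -[X in X * _](powRr1 (ltW hp)) -powRD.
  by rewrite (_ : 1 + -1 * (1 - alpha) = alpha) ?lexx//; ring.
by rewrite (lt0r_neq0 hp) implybT.
Qed.

Lemma Psi_uniform f : in_L +oo%E f -> forall e : R, 0 < e ->
  exists2 d : R, 0 < d & forall x y, `|x - y| < d -> modulus (Psi f x - Psi f y) < e.
Proof.
move=> Lf e e0.
(* Any exponent would do. Below, [|k| + 1] replaces [k], whose sign is not known. *)
have half : 0 < (2^-1 : R) < 1 by lra.
have [k Hk] := Psi_holder Lf half.
have k1 : 0 < `|k| + 1 by rewrite ltr_wpDl.
have ek : 0 < e / (`|k| + 1) by rewrite divr_gt0.
exists ((e / (`|k| + 1)) ^+ 2); first by rewrite exprn_gt0.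
move=> x y xy; have := Hk (x - y) y; rewrite subrKC => /le_lt_trans; apply.
rewrite powR12_sqrt//.
have s0 := sqrtr_ge0 `|x - y|.
have s1 : Num.sqrt `|x - y| < e / (`|k| + 1).
  by rewrite -[ltRHS](ger0_norm (ltW ek)) -[ltRHS]sqrtr_sqr ltr_sqrt// exprn_gt0.
apply: (@le_lt_trans _ _ ((`|k| + 1) * Num.sqrt `|x - y|)).
  by rewrite ler_wpM2r// (le_trans (ler_norm k))// lerDl.
by rewrite mulrC -ltr_pdivlMr.
Qed.

(* Barbalat's argument: a square-integrable function taking values of modulus at
   least e arbitrarily far out would, by uniform continuity, have a mass bounded
   below on far away intervals. *)
Lemma Psi_vanishes f : in_L +oo%E f -> forall e : R, 0 < e ->
  exists X : R, forall s, X < `|s| -> modulus (Psi f s) < e.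
Proof.
move=> Lf e e0; have iF := cintegrable_truncF Lf.
have [d d0 Hd] := Psi_uniform Lf (divr_gt0 e0 (ltr0n _ 2)).
(* Regarded as complex-valued so that the convergence of tails applies. *)
pose g (s : R) : R[i] := (modulus (Psi f s) ^+ 2)%:C.
have ig : cintegrable g.
  split; first exact: (plancherel_le iF (integrable_sqr_truncF Lf)).1.
  by rewrite (_ : _ \o _ = cst 0%E)//; exact: integrable0.
pose c := (e / 2) ^+ 2 * d; have c0 : 0 < c by rewrite mulr_gt0// exprn_gt0// divr_gt0.
have /cvgrPdist_lt/(_ c c0)[n _ /(_ n (leqnn n))] := cvg_tail_integral ig.
(* Beyond n + d the interval [I] of length d about s misses [-n, n]; on it |Psi f| stays at least
   e/2, which accounts for the value of [c]. *)
move=> tail; rewrite /= sub0r normrN in tail; exists (n%:R + d) => s ns.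
rewrite ltNge; apply/negP => es.
pose I : set R := `[s - d / 2, s + d / 2]%classic.
have mI : measurable (I : set lebesgueR).
  by apply: borel_lebesgue_measurable; exact: measurable_itv.
have muI : (mu I = d%:E)%E.
  rewrite completed_lebesgue_measureE; last exact: measurable_itv.
  rewrite lebesgue_measure_itv/= lte_fin ifT; last lra.
  by rewrite -EFinB; congr EFin; lra.
have mC : measurable (`[- n%:R, n%:R]%classic : set lebesgueR).
  by apply: borel_lebesgue_measurable; exact: measurable_itv.
have iD := cintegrableB ig (cintegrable_cutoff mC ig).
have iE : (\int[mu]_x (\1_I x)%:E = d%:E)%E.
  by rewrite integral_indic// setIT; exact: muI.
have i1 : mu.-integrable setT (EFin \o \1_I).
  apply/integrableP; split.
    by apply/measurable_EFinP; exact: (@measurable_indic _ lebesgueR R setT I mI).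
  under eq_integral do rewrite /= ger0_norm//.
  by rewrite iE ltry.
have iI : mu.-integrable setT (EFin \o (fun t => (e / 2) ^+ 2 * \1_I t)).
  exact: (@integrableZl _ lebesgueR R mu setT measurableT ((e / 2) ^+ 2) (EFin \o \1_I)).
have : c <= Rintegral mu setT (fun t => modulus (g t - cutoff `[- n%:R, n%:R]%classic g t)).
  rewrite (_ : c = Rintegral mu setT (fun t => (e / 2) ^+ 2 * \1_I t)); last first.
    rewrite (RintegralZl _ measurableT i1).
    by rewrite /Rintegral iE.
  apply: le_Rintegral => //; first exact: cintegrable_modulus iD.
  move=> t _; rewrite indicE cutoffE; have [tI|_] := boolP (t \in I); last first.
    by rewrite mulr0 modulus_ge0.
  move: tI; rewrite /I inE/= in_itv/= => /andP[t1 t2]; rewrite mulr1 ifF; last first.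
    apply/negP; rewrite inE/= in_itv/= -ler_norml => tn.
    have := ler_normD t (s - t); rewrite addrC subrK.
    have : `|s - t| <= d / 2 by rewrite ler_norml; apply/andP; clear -t1 t2; split; lra.
    clear -ns tn d0; lra.
  rewrite subr0 modulus_real ger0_norm ?sqr_ge0//.
  rewrite lerXn2r ?nnegrE ?modulus_ge0 ?divr_ge0 ?(ltW e0)//.
  have st : `|s - t| < d by rewrite ltr_norml; apply/andP; clear -t1 t2 d0; split; lra.
  have := Hd _ _ st; have := modulusD (Psi f s - Psi f t) (Psi f t).
  rewrite subrK; clear -es; lra.
by move=> /le_trans/(_ (ler_norm _))/le_lt_trans/(_ tail); rewrite ltxx.
Qed.

(** Balls in [R[i]] have radii in [R[i]]; since positive elements are real, real estimates
    suffice. *)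
Lemma ltC_pos (e : R[i]) : 0 < e -> exists2 r : R, 0 < r & e = r%:C.
Proof.
case: e => a b; rewrite ltcE/= => /andP[/eqP-> a0]; exists a => //.
Qed.

Lemma normC_modulus (z : R[i]) : `|z| = (modulus z)%:C.
Proof. by rewrite normc_def modulusE. Qed.

Lemma Psi_unif_continuous f : in_L +oo%E f ->
  unif_continuous (Psi f : R -> R[i]^o).
Proof.
move=> Lf E; rewrite -entourage_from_ballE => -[e /= e0 eE].
have [r r0 er] := ltC_pos e0; have [d d0 Hd] := Psi_uniform Lf r0.
rewrite nbhs_simpl/= -entourage_from_ballE; exists d => // -[x y] /= xy; apply: eE => /=.
rewrite -ball_normE /= normC_modulus er ltcR; apply: Hd.
by move: xy; rewrite -ball_normE.
Qed.

Lemma Psi_cvg0 f : in_L +oo%E f ->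
  (Psi f : R -> R[i]^o) @ +oo --> (0 : R[i]^o) /\
  (Psi f : R -> R[i]^o) @ -oo --> (0 : R[i]^o).
Proof.
move=> Lf; split; apply/cvgrPdist_lt => e e0; have [r r0 ->] := ltC_pos e0;
  have [X HX] := Psi_vanishes Lf r0.
- exists `|X|; split; first exact: num_real.
  move=> s Xs; rewrite sub0r normrN normC_modulus ltcR HX//.
  by rewrite (le_lt_trans (ler_norm X))// (lt_le_trans Xs)// ler_norm.
- exists (- `|X|); split; first exact: num_real.
  move=> s Xs; rewrite sub0r normrN normC_modulus ltcR HX//.
  rewrite (le_lt_trans (ler_norm X))// -(normrN s) (lt_le_trans _ (ler_norm (- s)))//.
  by rewrite ltrNr.
Qed.

End regularity.

(** * Sharpness *)

Section sharpness.
Variable R : realType.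
Local Notation mu := (@completed_lebesgue_measure R).
Local Notation lebesgueR := (caratheodory_type (@wlength R idfun)^*%mu).
Local Notation Re := (@complex.Re R).

(* The factor exp(ist) turns the increment of the transform at s into the one at 0,
   and the factor i turns exp(-iht) - 1 into a function of real part sin(ht). *)
Definition modulated_halfline (s t : R) : R[i] :=
  (\1_(`]1, +oo[%classic : set R) t)%:C * ('i * expi (s * t)).

Lemma modulated_halfline_in_L s : in_L +oo%E (modulated_halfline s).
Proof.
split.
  apply: lebesgue_measurableM.
    apply: lebesgue_measurable_real.
    apply: (@measurable_indic _ lebesgueR R setT).
    by apply: borel_lebesgue_measurable; exact: measurable_itv.
  apply: lebesgue_measurableM; first exact: lebesgue_measurable_cst.
  have := lebesgue_measurable_expi (- s).
  by under [X in lebesgue_measurable X]eq_fun do rewrite mulNr opprK.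
apply: (@le_lt_trans _ _ 1%E); last exact: ltry.
rewrite lnorm_ooE; apply/ess_supP; apply: nearW => t.
rewrite lee_fin /modulated_halfline !modulusM modulus_expi mulr1 modulus_real.
rewrite indicE modulusE /= expr0n add0r expr1n sqrtr1 mulr1.
by case: (_ \in _); rewrite ?normr0 ?normr1.
Qed.

Lemma Re_increment_modulated (s h t : R) :
  Re ((expi (- (h * t)) - 1) * (expi (- (s * t)) * truncF (modulated_halfline s) t)) =
  ((fun t => sin (h * t) * t `^ (- 2)) \_ `]1, +oo[%classic) t.
Proof.
rewrite truncFE /modulated_halfline indicE patchE.
have [|_] := boolP (t \in _); last by rewrite mul0r !mulr0.
rewrite inE => tI; have t1 : 1 < t by move: tI; rewrite /= in_itv/= andbT.
rewrite mul1r (_ : outside_unit _ t = t `^ (- 2)); last first.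
  by rewrite /outside_unit gtr0_norm ?(lt_trans ltr01 t1)// leNgt t1.
rewrite (_ : _ * (_ * _) = (t `^ (- 2))%:C * ('i * (expi (- (h * t)) - 1)) *
    (expi (- (s * t)) * expi (s * t))); last by ring.
rewrite -expiD addNr expi0 mulr1.
have ReZ (a : R) (z : R[i]) : Re (a%:C * z) = a * Re z by rewrite ReM /= mul0r subr0.
by rewrite ReZ mulrC ReM ImB /= mul0r sub0r subr0 mul1r sinN opprK.
Qed.

(** Up to T = 1/h the argument of the sine stays in [0, 1], so sin(ht) >= ht/2 and the integrand is
    at least h/(2t), the source of the logarithm. Beyond T the sine is only bounded below by -1, and
    the tail of t^(-2) costs h. *)
Lemma increment_lower_bound (s h : R) : 0 < h < 1 ->
  h * (- ln h) / 2 - h <= modulus (Psi (modulated_halfline s) (s + h) -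
                                   Psi (modulated_halfline s) s).
Proof.
move=> /andP[h0 h1]; set f := modulated_halfline s.
have Lf := modulated_halfline_in_L s; have iF := cintegrable_truncF Lf.
have iI := cintegrable_increment s h iF.
pose T := h^-1; have T1 : 1 < T by rewrite invf_gt1.
have T0 : 0 < T by rewrite (lt_trans ltr01).
pose phi t := sin (h * t) * t `^ (- 2).
have B (i : interval R) : measurable ([set` i] : set lebesgueR).
  by apply: borel_lebesgue_measurable; exact: measurable_itv.
have iphi : mu.-integrable `]1, +oo[ (EFin \o phi).
  apply/(integrable_mkcond _ (B _)); apply: eq_integrable iI.1 => // t _.
  by rewrite /= Re_increment_modulated restrict_EFin.
apply: le_trans (norm_Re_modulus _); apply: le_trans (ler_norm _).
rewrite /Psi (fourier_increment _ _ iF) /=.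
rewrite (_ : Rintegral mu setT _ = Rintegral mu `]1, +oo[ phi); last first.
  rewrite [RHS]Rintegral_mkcond; apply: eq_Rintegral => t _.
  exact: Re_increment_modulated.
rewrite (_ : `]1, +oo[%classic = `]1, T] `|` `]T, +oo[); last first.
  apply/seteqP; split=> t /=; rewrite !in_itv/= !andbT.
    by move=> ->; case: (leP t T); [left|right].
  by move=> [/andP[]//|]; exact: lt_trans.
have i1 : mu.-integrable `]1, T] (EFin \o phi).
  by apply: integrableS iphi => //; apply: subset_itvl.
have i2 : mu.-integrable `]T, +oo[ (EFin \o phi).
  by apply: integrableS iphi => //; apply: subset_itvr; rewrite bnd_simp ltW.
rewrite Rintegral_setU//; last 2 first.
- rewrite (_ : _ `|` _ = `]1, +oo[%classic)//.
  apply/seteqP; split=> t /=; rewrite !in_itv/= !andbT; last first.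
    by move=> ->; case: (leP t T); [left|right].
  by move=> [/andP[]//|]; exact: lt_trans.
- apply/disj_set2P; apply/seteqP; split=> t //=.
  by rewrite !in_itv/= andbT => -[/andP[_ t1]]; rewrite ltNge t1.
have c1 : {within `[1, T], continuous (fun x : R => h / 2 / x)}.
  apply: continuous_in_subspaceT => x; rewrite inE/= in_itv/= => /andP[x1 _].
  apply: cvgM; first exact: cvg_cst.
  by apply: inv_continuous; rewrite gt_eqF// (lt_le_trans _ x1).
have j1 : lebesgue_measure.-integrable `[1, T] (EFin \o (fun x => h / 2 / x)).
  by apply: continuous_compact_integrable => //; exact: segment_compact.
have j1' : lebesgue_measure.-integrable `]1, T] (EFin \o (fun x => h / 2 / x)).
  by apply: integrableS j1 => //; apply: subset_itvr; rewrite bnd_simp.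
have E1 : Rintegral mu `]1, T] (fun x => h / 2 / x) = h / 2 * - ln h.
  rewrite Rintegral_completed//; last first.
    by have /measurable_EFinP := measurable_int lebesgue_measure j1'.
  rewrite Rintegral_itv_obnd_cbnd// /Rintegral integral_inv ?divr_ge0 ?(ltW h0)//.
  by rewrite /T lnV.
have m2 : measurable_fun [set: R] (fun x : R => (x `^ (- 2))%:E).
  by apply/measurable_EFinP; exact: measurable_powR.
have I2 : (\int[lebesgue_measure]_(x in `]T, +oo[) (x `^ (- 2))%:E = h%:E)%E.
  rewrite integral_itv_obnd_cbnd; last exact: measurable_funTS.
  rewrite integral_powRN ?ltr1n//; congr EFin.
  rewrite (_ : 1 - 2 = -1 :> R) ?powR_inv1 ?(ltW T0)//; last by ring.
  by rewrite /T invrK (_ : 2 - 1 = 1 :> R) ?divr1//; ring.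
have j2 : mu.-integrable `]T, +oo[ (EFin \o (fun x : R => x `^ (- 2))).
  apply: integrable_completed; first exact: measurable_itv.
  apply/integrableP; split; first exact: measurable_funTS.
  under eq_integral do rewrite /= ger0_norm ?powR_ge0//.
  by rewrite I2 ltry.
have E2 : Rintegral mu `]T, +oo[ (fun x => x `^ (- 2)) = h.
  rewrite Rintegral_completed//; first by rewrite /Rintegral I2.
  by apply: measurable_funTS; exact: measurable_powR.
apply: lerD.
  rewrite mulrAC -E1; apply: le_Rintegral => //.
    by apply: integrable_completed.
  move=> t; rewrite /= in_itv/= => /andP[t1 tT].
  have t0 : 0 < t by rewrite (lt_trans ltr01 t1).
  have ht : h * t <= 1 by rewrite -ler_pdivlMl// mulr1.
  rewrite /phi powRN powR_mulrn ?(ltW t0)//.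
  rewrite ler_pdivlMr ?exprn_gt0// (_ : h / 2 / t * t ^+ 2 = h * t / 2); last first.
    by field; rewrite gt_eqF.
  by apply: half_le_sin; rewrite ht mulr_ge0// ltW.
rewrite lerNl -[leRHS]E2.
have -> : - Rintegral mu `]T, +oo[ phi = Rintegral mu `]T, +oo[ (fun t => - 1 * phi t).
  by rewrite (RintegralZl _ (B _) i2) mulN1r.
apply: le_Rintegral => //.
  exact: (@integrableZl _ lebesgueR R mu _ (B _) (-1) _ i2).
by move=> t _; rewrite /phi mulN1r -mulNr ler_piMl ?powR_ge0.
Qed.

(** The loss h is at most half of the main term once the logarithm reaches 4. *)
Lemma increment_log_lower_bound (s h : R) : 0 < h -> 4 <= - ln h ->
  h * (- ln h) / 4 <= modulus (Psi (modulated_halfline s) (s + h) -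
                               Psi (modulated_halfline s) s).
Proof.
move=> h0 l4; have h1 : h < 1.
  by rewrite -ltr_ln ?posrE// ln1; lra.
have h01 : 0 < h < 1 by rewrite h0.
apply: le_trans (increment_lower_bound s h01).
have : h * 4 <= h * - ln h by rewrite ler_pM2l.
lra.
Qed.

(** The function is chosen from s alone: its increment has the full order h log(1/h) as h decreases
    to 0, so one function defeats every psi. *)
Lemma Psi_sharp (s : R) (psi : R -> R) : (forall h, 0 < psi h) ->
  psi =o_ (dnbhs (0 : R)) (fun h => h * ln `|h|) ->
  ~ bounded_near (fun h => modulus
      ((Psi (modulated_halfline s) (s + h) - Psi (modulated_halfline s) s)
        / (psi h)%:C)) (dnbhs (0 : R)).
Proof.
move=> psi0 /eqoP psio [M0 [_ HM]].
pose M : R := `|M0| + 1.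
have M1 : 0 < M by rewrite ltr_wpDl.
have /HM {}HM : M0 < M by rewrite (le_lt_trans (ler_norm M0))// ltrDl.
(* With this epsilon, M psi(h) is at most h log(1/h) / 8, half of the lower bound for the
   increment. *)
have e0 : 0 < (8 * M)^-1 by rewrite invr_gt0 mulr_gt0.
have {}psio := psio _ e0.
have : \forall h \near dnbhs (0 : R), modulus ((Psi (modulated_halfline s) (s + h) -
    Psi (modulated_halfline s) s) / (psi h)%:C) <= M /\
    `|psi h| <= (8 * M)^-1 * `|h * ln `|h| |.
  near=> h; split; last by near: h.
  have : `|modulus ((Psi (modulated_halfline s) (s + h) -
    Psi (modulated_halfline s) s) / (psi h)%:C)| <= M by near: h.
  by rewrite ger0_norm ?modulus_ge0.
rewrite near_withinE => /nbhs_ballP[d d0 Hd].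
have {}d0 : 0 < d := d0.
pose h := Num.min (d / 2) (expR (- 4)).
have h0 : 0 < h by rewrite lt_min divr_gt0 ?expR_gt0.
have hd : h < d by rewrite gt_min; apply/orP; left; lra.
have l4 : 4 <= - ln h.
  rewrite lerNr -(expRK (- 4)) ler_ln ?posrE ?expR_gt0//.
  by rewrite /h ge_min lexx orbT.
have bh : ball 0 d h by rewrite -ball_normE /= sub0r normrN gtr0_norm.
have [] := Hd h bh (lt0r_neq0 h0).
have := increment_log_lower_bound s h0 l4.
set z := Psi _ _ - Psi _ _ => zl.
rewrite modulusM ComplexField.Normc.normcV modulus_real (gtr0_norm h0) (gtr0_norm (psi0 h)).
rewrite normrM (gtr0_norm h0) ltr0_norm; last by rewrite -oppr_gt0 (lt_le_trans _ l4).
rewrite ler_pdivrMr// => zM pl.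
have : M * psi h <= h * - ln h / 8.
  rewrite -ler_pdivlMl//; apply: le_trans pl _.
  by rewrite le_eqVlt; apply/orP; left; apply/eqP; field; rewrite gt_eqF.
have : 0 < h * - ln h by rewrite mulr_gt0// (lt_le_trans _ l4).
lra.
Unshelve. all: by end_near. Qed.

Lemma Psi_not_lipschitz : ~ lipschitz_continuous (Psi (modulated_halfline 0)).
Proof.
(* For this h the lower bound for the increment is exactly (|k| + 1) h, which exceeds k h. *)
move=> [k Hk]; pose h : R := expR (- (4 * (`|k| + 1))).
have h0 : 0 < h by exact: expR_gt0.
have lE : - ln h = 4 * (`|k| + 1) by rewrite /h expRK opprK.
have l4 : 4 <= - ln h by rewrite lE; have := normr_ge0 k; lra.
have := increment_log_lower_bound 0 h0 l4.
move=> /le_trans/(_ (Hk h 0)); rewrite powRr1// gtr0_norm// lE.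
rewrite (_ : h * _ / 4 = (`|k| + 1) * h); last by field.
by rewrite ler_pM2r//; have := ler_norm k; lra.
Qed.

End sharpness.


Theorem theorem2p1 (R : realType) :
  (forall f : R -> R[i], in_L +oo%E f ->
    (lnorm +oo%E (Psi f) <= lnorm 1%E (truncF f))%E
    /\ (forall r : \bar R, (2^-1%:E < r)%E -> in_L r (truncF f))
    /\ (forall q : \bar R, (2%:E <= q)%E -> in_L q (Psi f))
    /\ ((Psi f : R -> R[i]^o) @ +oo --> (0 : R[i]^o)
        /\ (Psi f : R -> R[i]^o) @ -oo --> (0 : R[i]^o))
    /\ unif_continuous (Psi f : R -> R[i]^o)
    /\ (forall h : R, 0 < `|h| < (expR 1)^-1 -> forall s : R,
          ((modulus (Psi f (s + h) - Psi f s))%:E <=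
            6%:E * lnorm +oo%E f * (`|h| * `|ln `|h| |)%:E)%E)
    /\ (forall alpha : R, 0 < alpha < 1 -> holder alpha (Psi f)))
  /\ (exists C : \bar R -> R, forall p q : \bar R,
        (2%:E <= q)%E -> (p^-1 + q^-1 = 1)%E ->
        forall f : R -> R[i], in_L +oo%E f ->
          (lnorm q (Psi f) <= (C p)%:E * lnorm p (truncF f))%E)
  /\ (forall (s : R) (psi : R -> R), (forall h, 0 < psi h) ->
        psi =o_ (dnbhs (0 : R)) (fun h => h * ln `|h|) ->
        exists2 f : R -> R[i], in_L +oo%E f &
          ~ bounded_near (fun h => modulus
              ((Psi f (s + h) - Psi f s) / (psi h)%:C)) (dnbhs (0 : R)))
  /\ (exists2 f : R -> R[i], in_L +oo%E f & ~ lipschitz_continuous (Psi f)).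
Proof.
split; [|split; [|split]].
- move=> f Lf; split; [|split; [|split; [|split; [|split; [|split]]]]].
  + exact: lnorm_oo_fourier_le (cintegrable_truncF Lf).
  + by move=> r r2; exact: truncF_in_L.
  + by move=> q q2; exact: Psi_in_L.
  + exact: Psi_cvg0.
  + exact: Psi_unif_continuous.
  + by move=> h h0 s; exact: Psi_log_modulus.
  + by move=> alpha a01; exact: Psi_holder.
- have [C HC] := choice (@hausdorff_young_constant R).
  by exists C => p q q2 pq f Lf; exact: HC.
- move=> s psi psi0 psio; exists (modulated_halfline s).
    exact: modulated_halfline_in_L.
  exact: Psi_sharp.
- exists (modulated_halfline 0); first exact: modulated_halfline_in_L.
  exact: Psi_not_lipschitz.
Qed.
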